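(* Let $t_1<t_2$ be real numbers and consider the (not necessarily periodic) linear impulsive Hamiltonian system $$x'=a(t)x+b(t)u,\quad u'=-c(t)x-a(t)u,\quad t\neq\tau_i,$$ $$x(\tau_i+)=\alpha_i x(\tau_i-),\quad u(\tau_i+)=\alpha_i u(\tau_i-)-\beta_i x(\tau_i-),\qquad i\in\mathbb Z,$$ where $a,b,c\in\mathrm{PC}[t_1,t_2]$, $b(t)>0$, and $\alpha_i,\beta_i$ are real numbers with $\alpha_i\neq0$ for all $i\in\mathbb Z$. If for every $t_0\in(t_1,t_2)$ $$\left[\int_{t_1}^{t_2}b(t)\exp\left(-2\int_{t_0}^{t}a(u)\,du\right)dt\right]\left[\int_{t_1}^{t_2}c^+(t)\,dt+\sum_{t_1\le\tau_i<t_2}\left(\frac{\beta_i}{\alpha_i}\right)^+\right]<4,$$ then the system is disconjugate on $[t_1,t_2]$.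
   Context: $\{\tau_i\}_{i\in\mathbb Z}$ is a sequence of real numbers (impulse points) with $\tau_i<\tau_{i+1}$ for all $i$, only finitely many of which lie in $[t_1,t_2]$. No periodicity is assumed. $\mathrm{PC}[t_1,t_2]$ is the set of real-valued functions $f:[t_1,t_2]\setminus\{\tau_i:i\in\mathbb Z\}\to\mathbb R$ that are continuous on $[t_1,t_2]\setminus\{\tau_i:i\in\mathbb Z\}$ and for which the left limit $f(\tau_i-)$ and the right limit $f(\tau_i+)$ exist (finite) at each impulse point $\tau_i$ in the interval (at an endpoint, only the one-sided limit from within the interval). A solution is a pair $(x,u)$ satisfying the differential equations for $t\neq\tau_i$, having one-sided limits at the impulse points, and satisfying the jump conditions there. A zero of $x$ is a real number $s$ with $x(s-)=0$ or $x(s+)=0$ (at a point of continuity this is $x(s)=0$; at an endpoint of $[t_1,t_2]$ the one-sided limit from within the interval is used). The system is called disconjugate on $[t_1,t_2]$ if and only if there is no real solution $(x,u)$ with $x$ nontrivial (not identically zero) and $x$ having two or more zeros on $[t_1,t_2]$. Notation: $c^+(t)=\max\{c(t),0\}$ and $(\beta_i/\alpha_i)^+=\max\{\beta_i/\alpha_i,0\}$. *)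

(* Defs.v *)
From Stdlib Require Import Reals ZArith List ClassicalEpsilon.
From Coquelicot Require Import Coquelicot.
Open Scope R_scope.

(* Functions on [t1, t2] minus the impulse points are represented by total
   functions R -> R.  When finitely many tau i lie in [t1, t2], the values off
   [imp_dom tau t1 t2] have no influence on PC, solutions or zeros. *)
Definition imp_dom (tau : Z -> R) (t1 t2 t : R) : Prop :=
  t1 <= t <= t2 /\ forall i : Z, t <> tau i.

Definition left_lim (f : R -> R) (s l : R) : Prop :=
  filterlim f (at_left s) (locally l).

Definition right_lim (f : R -> R) (s l : R) : Prop :=
  filterlim f (at_right s) (locally l).

Definition has_impulse_limits (tau : Z -> R) (t1 t2 : R) (f : R -> R) : Prop :=
  forall i : Z,
    (t1 < tau i <= t2 -> exists l : R, left_lim f (tau i) l) /\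
    (t1 <= tau i < t2 -> exists l : R, right_lim f (tau i) l).

Definition PC (tau : Z -> R) (t1 t2 : R) (f : R -> R) : Prop :=
  continuous_on (imp_dom tau t1 t2) f /\ has_impulse_limits tau t1 t2 f.

(* [is_derive] relative to a subset: Coquelicot's [is_derive f t l] is the
   case where [D] is the whole line.  It gives the one-sided derivative at an
   endpoint of [t1, t2] that is not an impulse point. *)
Definition is_derive_within (D : R -> Prop) (f : R -> R) (t l : R) : Prop :=
  filterdiff f (within D (locally t)) (fun h : R => scal h l).

(* An impulse point equal to t1 or t2 carries no jump condition: one of its
   two one-sided limits lies outside the interval. *)
Definition is_solution (tau : Z -> R) (t1 t2 : R) (a b c : R -> R)
    (alpha beta : Z -> R) (x u : R -> R) : Prop :=
  (forall t : R, imp_dom tau t1 t2 t ->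
     is_derive_within (imp_dom tau t1 t2) x t (a t * x t + b t * u t) /\
     is_derive_within (imp_dom tau t1 t2) u t (- c t * x t - a t * u t)) /\
  has_impulse_limits tau t1 t2 x /\
  has_impulse_limits tau t1 t2 u /\
  (forall i : Z, t1 < tau i < t2 ->
     forall xm xp um up : R,
       left_lim x (tau i) xm -> right_lim x (tau i) xp ->
       left_lim u (tau i) um -> right_lim u (tau i) up ->
       xp = alpha i * xm /\ up = alpha i * um - beta i * xm).

Definition is_zero (t1 t2 : R) (x : R -> R) (s : R) : Prop :=
  (t1 < s <= t2 /\ left_lim x s 0) \/ (t1 <= s < t2 /\ right_lim x s 0).

Definition nontrivial_on (D : R -> Prop) (x : R -> R) : Prop :=
  exists t : R, D t /\ x t <> 0.

Definition disconjugate (tau : Z -> R) (t1 t2 : R) (a b c : R -> R)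
    (alpha beta : Z -> R) : Prop :=
  ~ exists x u : R -> R,
      is_solution tau t1 t2 a b c alpha beta x u /\
      nontrivial_on (imp_dom tau t1 t2) x /\
      exists s1 s2 : R, s1 <> s2 /\ is_zero t1 t2 x s1 /\ is_zero t1 t2 x s2.

Definition finitely_many (P : Z -> Prop) : Prop :=
  exists l : list Z, forall i : Z, P i -> In i l.

Definition is_Zsum (P : Z -> Prop) (f : Z -> R) (S : R) : Prop :=
  exists l : list Z,
    NoDup l /\ (forall i : Z, In i l <-> P i) /\
    S = fold_right Rplus 0 (map f l).

(* The sum of f over {i | P i}; meaningful when this set is finite, in which
   case [is_Zsum P f] holds of exactly one number. *)
Definition Zsum (P : Z -> Prop) (f : Z -> R) : R :=
  epsilon (inhabits 0) (is_Zsum P f).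

(* Main.v *)
Require Import Defs.
From Corelib Require Import ssreflect.
From Stdlib Require Import Reals ZArith List FinFun Lia Lra Classical ClassicalEpsilon.
From Coquelicot Require Import Coquelicot.
Local Open Scope general_if_scope.
Open Scope R_scope.

(** Dividing a solution [(x, u)] by the product of the multipliers [alpha i] of
    the impulse points already passed gives a pair [(z, w)] that satisfies the
    same differential equations, where [z] has no jumps and [w] jumps by
    [- (beta i / alpha i) z] ([normalize_solution]).  The zeros of [x] and [z]
    are the same.

    Let [s1 < s2] be two zeros, and suppose that [z] is not identically zero
    between them.  Let [t0] be a point of [(s1, s2)] where [|z|] reaches its
    maximum [M] there ([max_abs_limit]), [A] the primitive of [a] that vanishes
    at [t0], [P] a primitive of [b exp (- 2 A)], and [V] a primitive of the
    positive part [c+] increased by [(beta i / alpha i)+] at each impulse point.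
    For each real [lam] the function
      [z w - 2 lam z exp (- A) + lam^2 P + M^2 V]
    has derivative [b (w - lam exp (- A))^2 + (M^2 c+ - c z^2) >= 0] and its
    jumps are nonnegative, so it is nondecreasing ([energy_increases]).  Use it
    with [lam] on [(s1, t0)] and with [- lam] on [(t0, s2)], and add the jump at
    [t0]: writing [B] and [S] for the two factors of the hypothesis, this gives
    [4 lam z(t0) <= lam^2 B + z(t0)^2 S] for every [lam], whence [4 <= B S]
    ([lyapunov_lower_bound]), a contradiction.  No Cauchy-Schwarz inequality for
    integrals of the unknown solution is needed, and the two zeros need not be
    consecutive.

    If [z] vanishes identically between the zeros, then [b w = 0] there, hence
    [w = 0], and a Gronwall estimate across the impulses ([norm_growth]) gives
    [z = 0] everywhere, so [x] is trivial ([zero_on_interval]).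

    All monotonicity statements rest on [piecewise_nondecreasing], which allows
    a finite set of exceptional points. *)

(** * One-sided limits *)

Lemma lim_plus (F : (R -> Prop) -> Prop) (FF : Filter F) (f g : R -> R) (l m : R) :
  filterlim f F (locally l) -> filterlim g F (locally m) ->
  filterlim (fun t => f t + g t) F (locally (l + m)).
Proof.
  intros Hf Hg.
  exact (filterlim_comp_2 f g Rplus Hf Hg
           (@filterlim_plus R_AbsRing R_NormedModule l m)).
Qed.

Lemma lim_mult (F : (R -> Prop) -> Prop) (FF : Filter F) (f g : R -> R) (l m : R) :
  filterlim f F (locally l) -> filterlim g F (locally m) ->
  filterlim (fun t => f t * g t) F (locally (l * m)).
Proof.
  intros Hf Hg.
  exact (filterlim_comp_2 f g Rmult Hf Hg (@filterlim_mult R_AbsRing l m)).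
Qed.

Lemma lim_scal (F : (R -> Prop) -> Prop) (FF : Filter F) (f : R -> R) (k l : R) :
  filterlim f F (locally l) -> filterlim (fun t => k * f t) F (locally (k * l)).
Proof.
  intros Hf. apply (lim_mult F FF (fun _ => k) f); [apply filterlim_const|exact Hf].
Qed.

Lemma left_lim_cont (f : R -> R) (t : R) : continuous f t -> left_lim f t (f t).
Proof.
  intros H. apply (filterlim_filter_le_1 (F := locally t)); [|exact H].
  apply filter_le_within.
Qed.

Lemma right_lim_cont (f : R -> R) (t : R) : continuous f t -> right_lim f t (f t).
Proof.
  intros H. apply (filterlim_filter_le_1 (F := locally t)); [|exact H].
  apply filter_le_within.
Qed.

Lemma cont_of_limits (f : R -> R) (t : R) :
  left_lim f t (f t) -> right_lim f t (f t) -> continuous f t.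
Proof.
  intros Hl Hr P HP.
  assert (Hl' := Hl P HP). assert (Hr' := Hr P HP).
  unfold filtermap, at_left, at_right, within in *.
  apply: filter_imp (filter_and _ _ Hl' Hr').
  intros s [H1 H2].
  destruct (Rtotal_order s t) as [h|[h|h]].
  - now apply H1.
  - subst s. exact (locally_singleton _ _ HP).
  - now apply H2.
Qed.

Lemma at_right_between (p q : R) : p < q -> at_right p (fun s => p < s < q).
Proof.
  intros H. assert (He : 0 < q - p) by lra.
  exists (mkposreal _ He). intros s Hs Hps.
  apply Rabs_def2 in Hs. simpl in Hs. unfold minus, plus, opp in Hs; simpl in Hs. lra.
Qed.

Lemma at_left_between (p q : R) : p < q -> at_left q (fun s => p < s < q).
Proof.
  intros H. assert (He : 0 < q - p) by lra.
  exists (mkposreal _ He). intros s Hs Hps.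
  apply Rabs_def2 in Hs. simpl in Hs. unfold minus, plus, opp in Hs; simpl in Hs. lra.
Qed.

Lemma locally_between (p q t : R) : p < t < q -> locally t (fun s => p < s < q).
Proof.
  intros H. apply (open_and (fun s => p < s) (fun s => s < q)).
  - apply open_gt.
  - apply open_lt.
  - exact H.
Qed.

(** A finite set avoids a punctured neighbourhood of every point. *)
Lemma locally_avoid (L : list R) (t : R) :
  locally t (fun s => s <> t -> ~ In s L).
Proof.
  induction L as [|x L IH].
  - now apply filter_forall.
  - assert (Hx : locally t (fun s => s <> t -> s <> x)).
    { destruct (Req_dec x t) as [->|Hxt].
      - now apply filter_forall.
      - assert (He : 0 < Rabs (x - t)) by (apply Rabs_pos_lt; lra).
        exists (mkposreal _ He). intros s Hs _ ->.
        unfold ball in Hs; simpl in Hs; unfold AbsRing_ball, abs, minus, plus, opp in Hs.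
        simpl in Hs. unfold Rminus in Hs. lra. }
    apply: filter_imp (filter_and _ _ IH Hx).
    intros s [H1 H2] Hs [->|Hin]; [now apply H2|now apply H1].
Qed.

Lemma at_right_avoid (L : list R) (t : R) : at_right t (fun s => ~ In s L).
Proof.
  apply: filter_imp (locally_avoid L t). intros s H Hs. apply H. lra.
Qed.

Lemma at_left_avoid (L : list R) (t : R) : at_left t (fun s => ~ In s L).
Proof.
  apply: filter_imp (locally_avoid L t). intros s H Hs. apply H. lra.
Qed.

Lemma locally_avoid_off (L : list R) (t : R) :
  ~ In t L -> locally t (fun s => ~ In s L).
Proof.
  intros Ht. apply: filter_imp (locally_avoid L t). intros s H.
  destruct (Req_dec s t) as [->|Hs]; [exact Ht|now apply H].
Qed.

(** * Monotonicity across finitely many exceptional points *)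

(** A function with nonnegative derivative off a finite set and upward jumps on
    that set increases from the right limit at the left end of an interval to
    the left limit at its right end. *)
Lemma piecewise_nondecreasing (L : list R) (f f' : R -> R) (p q lp lq : R) :
  p < q ->
  (forall t, p < t < q -> ~ In t L -> is_derive f t (f' t) /\ 0 <= f' t) ->
  (forall t, p < t < q -> In t L ->
     exists lm lr, left_lim f t lm /\ right_lim f t lr /\ lm <= lr) ->
  right_lim f p lp -> left_lim f q lq -> lp <= lq.
Proof.
  revert p q lp lq. induction L as [|x L IH]; intros p q lp lq Hpq Hd Hj Hp Hq.
  - assert (Hmono : forall r s, p < r -> r <= s -> s < q -> f r <= f s).
    { intros r s Hr Hrs Hs.
      destruct (MVT_gen f r s f') as [c [Hc E]].
      - intros t Ht. rewrite (Rmin_left r s Hrs) (Rmax_right r s Hrs) in Ht.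
        apply Hd; [lra|auto].
      - intros t Ht. rewrite (Rmin_left r s Hrs) (Rmax_right r s Hrs) in Ht.
        apply continuity_pt_filterlim. apply: ex_derive_continuous.
        exists (f' t). apply Hd; [lra|auto].
      - rewrite (Rmin_left r s Hrs) (Rmax_right r s Hrs) in Hc.
        destruct (Hd c) as [_ Hc']; [lra|auto|].
        assert (0 <= f' c * (s - r)) by (apply Rmult_le_pos; lra). lra. }
    pose (m := (p + q) / 2).
    apply Rle_trans with (f m).
    + apply (filterlim_le (F := at_right p) f (fun _ => f m) lp (f m)).
      * apply: filter_imp (at_right_between p m _); [|unfold m; lra].
        intros s Hs. apply Hmono; unfold m in *; lra.
      * exact Hp.
      * apply filterlim_const.
    + apply (filterlim_le (F := at_left q) (fun _ => f m) f (f m) lq).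
      * apply: filter_imp (at_left_between m q _); [|unfold m; lra].
        intros s Hs. apply Hmono; unfold m in *; lra.
      * apply filterlim_const.
      * exact Hq.
  - destruct (Rlt_dec p x) as [h1|h1]; [destruct (Rlt_dec x q) as [h2|h2]|].
    + destruct (Hj x) as (lm & lr & Hl & Hr & Hle); [lra|now left|].
      apply Rle_trans with lm; [|apply Rle_trans with lr; [exact Hle|]].
      * apply (IH p x); auto.
        -- intros t Ht Hn. apply Hd; [lra|]. intros [->|H]; [lra|tauto].
        -- intros t Ht Hn. apply Hj; [lra|now right].
      * apply (IH x q); auto.
        -- intros t Ht Hn. apply Hd; [lra|]. intros [->|H]; [lra|tauto].
        -- intros t Ht Hn. apply Hj; [lra|now right].
    + apply (IH p q); auto.
      * intros t Ht Hn. apply Hd; [lra|]. intros [->|H]; [lra|tauto].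
      * intros t Ht Hn. apply Hj; [lra|now right].
    + apply (IH p q); auto.
      * intros t Ht Hn. apply Hd; [lra|]. intros [->|H]; [lra|tauto].
      * intros t Ht Hn. apply Hj; [lra|now right].
Qed.

(** * Piecewise continuous functions and their integrals *)

(** Functions continuous off the finite set [L] with finite one-sided limits
    everywhere. *)
Definition piecewise_continuous (L : list R) (f : R -> R) : Prop :=
  (forall t, ~ In t L -> continuous f t) /\
  (forall t, (exists l, left_lim f t l) /\ (exists l, right_lim f t l)).

Lemma pwc_comp (L : list R) (f phi : R -> R) :
  (forall y, continuous phi y) ->
  piecewise_continuous L f -> piecewise_continuous L (fun t => phi (f t)).
Proof.
  intros Hphi [H1 H2]. split.
  - intros t Ht. apply (continuous_comp f phi); auto.
  - intros t. destruct (H2 t) as [[l Hl] [r Hr]]. split.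
    + exists (phi l). exact (filterlim_comp _ _ _ f phi _ _ _ Hl (Hphi l)).
    + exists (phi r). exact (filterlim_comp _ _ _ f phi _ _ _ Hr (Hphi r)).
Qed.

Lemma pwc_plus (L : list R) (f g : R -> R) :
  piecewise_continuous L f -> piecewise_continuous L g ->
  piecewise_continuous L (fun t => f t + g t).
Proof.
  intros [H1 H2] [G1 G2]. split.
  - intros t Ht. apply (lim_plus _ _ f g); [now apply H1|now apply G1].
  - intros t. destruct (H2 t) as [[l Hl] [r Hr]], (G2 t) as [[l' Hl'] [r' Hr']]. split.
    + exists (l + l'). now apply (lim_plus _ _ f g).
    + exists (r + r'). now apply (lim_plus _ _ f g).
Qed.

Lemma pwc_mult_cont (L : list R) (f g : R -> R) :
  piecewise_continuous L f -> (forall t, continuous g t) ->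
  piecewise_continuous L (fun t => f t * g t).
Proof.
  intros [H1 H2] Hg. split.
  - intros t Ht. apply (lim_mult _ _ f g); [now apply H1|apply Hg].
  - intros t. destruct (H2 t) as [[l Hl] [r Hr]]. split.
    + exists (l * g t). apply (lim_mult _ _ f g); [exact Hl|now apply left_lim_cont].
    + exists (r * g t). apply (lim_mult _ _ f g); [exact Hr|now apply right_lim_cont].
Qed.

Lemma pwc_ex_RInt (L : list R) (f : R -> R) (p q : R) :
  piecewise_continuous L f -> ex_RInt f p q.
Proof.
  intros [H1 H2].
  assert (main : forall L p q, p < q ->
            (forall t, p < t < q -> ~ In t L -> continuous f t) -> ex_RInt f p q).
  { clear L H1 p q. induction L as [|x L IH]; intros p q Hpq Hc.
    - destruct (H2 p) as [_ [lp Hp]], (H2 q) as [[lq Hq] _].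
      destruct (C0_extension_lt f lp lq p q Hpq) as (g & Hg & Hfg & _); auto.
      { intros t Ht. apply Hc; auto. }
      apply (ex_RInt_ext g).
      + intros t Ht. rewrite Rmin_left in Ht; [|lra]. rewrite Rmax_right in Ht; [|lra].
        now apply Hfg.
      + apply: ex_RInt_continuous. intros t _. apply Hg.
    - destruct (Rlt_dec p x) as [h1|h1]; [destruct (Rlt_dec x q) as [h2|h2]|].
      + apply (ex_RInt_Chasles f p x q).
        * apply IH; auto. intros t Ht Hn. apply Hc; [lra|]. intros [->|H]; [lra|tauto].
        * apply IH; auto. intros t Ht Hn. apply Hc; [lra|]. intros [->|H]; [lra|tauto].
      + apply IH; auto. intros t Ht Hn. apply Hc; [lra|]. intros [->|H]; [lra|tauto].
      + apply IH; auto. intros t Ht Hn. apply Hc; [lra|]. intros [->|H]; [lra|tauto]. }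
  destruct (Rtotal_order p q) as [h|[->|h]].
  - apply (main L); auto.
  - apply ex_RInt_point.
  - apply ex_RInt_swap. apply (main L); auto.
Qed.

Lemma pwc_primitive_cont (L : list R) (f : R -> R) (r t : R) :
  piecewise_continuous L f -> continuous (RInt f r) t.
Proof.
  intros Hf. apply (continuous_RInt_1 f r).
  apply filter_forall. intros s. apply: RInt_correct. now apply (pwc_ex_RInt L).
Qed.

Lemma pwc_primitive_derive (L : list R) (f : R -> R) (r t : R) :
  piecewise_continuous L f -> ~ In t L -> is_derive (RInt f r) t (f t).
Proof.
  intros Hf Ht. apply (is_derive_RInt f _ r).
  - apply filter_forall. intros s. apply: RInt_correct. now apply (pwc_ex_RInt L).
  - now apply Hf.
Qed.

Lemma pwc_RInt_nonneg (L : list R) (f : R -> R) (p q : R) :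
  piecewise_continuous L f -> p <= q ->
  (forall t, p < t < q -> ~ In t L -> 0 <= f t) -> 0 <= RInt f p q.
Proof.
  intros Hf Hpq Hpos. destruct Hpq as [Hpq| ->].
  2: { rewrite RInt_point. apply Rle_refl. }
  replace 0 with (RInt f p p) by (rewrite RInt_point; reflexivity).
  apply (piecewise_nondecreasing L (RInt f p) f p q); auto.
  - intros t Ht Hn. split; [|auto]. now apply (pwc_primitive_derive L).
  - intros t Ht Hn. exists (RInt f p t), (RInt f p t). split; [|split; [|apply Rle_refl]].
    + apply left_lim_cont. now apply (pwc_primitive_cont L).
    + apply right_lim_cont. now apply (pwc_primitive_cont L).
  - apply right_lim_cont. now apply (pwc_primitive_cont L).
  - apply left_lim_cont. now apply (pwc_primitive_cont L).
Qed.

(** The one-sided limits of a continuous function with removable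
    discontinuities on a finite set, and vanishing at both ends of an interval,
    reach their largest absolute value at an interior point. *)
Lemma max_abs_limit (L : list R) (f : R -> R) (p q : R) :
  p < q ->
  (forall t, p < t < q -> ~ In t L -> continuous f t) ->
  (forall t, p < t < q -> exists l, left_lim f t l /\ right_lim f t l) ->
  right_lim f p 0 -> left_lim f q 0 ->
  exists t0 z0, p < t0 < q /\ left_lim f t0 z0 /\ right_lim f t0 z0 /\
    forall t l, p < t < q -> left_lim f t l -> Rabs l <= Rabs z0.
Proof.
  intros Hpq Hc Hlim Hp Hq.
  (* the left regularization of f, continuous inside the interval *)
  pose (g := fun t => epsilon (inhabits 0) (fun l => left_lim f t l)).
  assert (gl : forall t, p < t < q -> left_lim f t (g t)).
  { intros t Ht. apply (epsilon_spec (inhabits 0) (fun l => left_lim f t l)).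
    destruct (Hlim t Ht) as [l [Hl _]]. now exists l. }
  assert (uniq : forall t l m, left_lim f t l -> left_lim f t m -> l = m).
  { intros t l m Hl Hm.
    exact (filterlim_locally_unique (F := at_left t) f l m Hl Hm). }
  assert (gr : forall t, p < t < q -> right_lim f t (g t)).
  { intros t Ht. destruct (Hlim t Ht) as [l [Hl Hr]].
    now rewrite (uniq t (g t) l (gl t Ht) Hl). }
  assert (gf : forall t, p < t < q -> ~ In t L -> f t = g t).
  { intros t Ht Hn. apply (uniq t); [|now apply gl].
    apply left_lim_cont. now apply Hc. }
  assert (gL : forall t l, p < t <= q -> left_lim f t l -> left_lim g t l).
  { intros t l Ht Hl. apply: filterlim_ext_loc Hl.
    apply: filter_imp (filter_and _ _ (at_left_avoid L t) (at_left_between p t _)); [|lra].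
    intros s [H1 H2]. apply gf; [lra|exact H1]. }
  assert (gR : forall t l, p <= t < q -> right_lim f t l -> right_lim g t l).
  { intros t l Ht Hl. apply: filterlim_ext_loc Hl.
    apply: filter_imp (filter_and _ _ (at_right_avoid L t) (at_right_between t q _)); [|lra].
    intros s [H1 H2]. apply gf; [lra|exact H1]. }
  destruct (C0_extension_lt g 0 0 p q Hpq) as (h & Hh & Hhg & Hhp & Hhq).
  { intros t Ht. apply cont_of_limits.
    - apply gL; [lra|now apply gl].
    - apply gR; [lra|now apply gr]. }
  { apply gR; [lra|exact Hp]. }
  { apply gL; [lra|exact Hq]. }
  destruct (continuity_ab_maj (fun t => Rabs (h t)) p q) as (t0 & Hmax & Ht0); [lra| |].
  { intros t _. apply continuity_pt_filterlim.
    apply (continuous_comp h Rabs); [apply Hh|apply continuous_Rabs]. }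
  assert (Hb : forall t l, p < t < q -> left_lim f t l -> Rabs l <= Rabs (h t0)).
  { intros t l Ht Hl. rewrite -(uniq t (g t) l (gl t Ht) Hl) -(Hhg t Ht).
    apply Hmax. lra. }
  destruct (Req_dec (h t0) 0) as [h0|h0].
  - exists ((p + q) / 2), (g ((p + q) / 2)).
    assert (Hm : p < (p + q) / 2 < q) by lra.
    repeat split; try lra; [now apply gl|now apply gr|].
    intros t l Ht Hl. apply Rle_trans with (Rabs (h t0)); [now apply (Hb t)|].
    rewrite h0 Rabs_R0. apply Rabs_pos.
  - assert (Hin : p < t0 < q).
    { split; destruct Ht0 as [A B].
      - destruct A as [A|A]; [exact A|]. subst t0. now rewrite Hhp in h0.
      - destruct B as [B|B]; [exact B|]. subst t0. now rewrite Hhq in h0. }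
    exists t0, (g t0). rewrite -(Hhg t0 Hin).
    split; [exact Hin|]. rewrite {1 2}(Hhg t0 Hin).
    split; [now apply gl|split; [now apply gr|exact Hb]].
Qed.

(** * Step functions *)

(** The points of [T] that precede [t], strictly or not. *)
Definition points_before (T : list R) (t : R) : list R :=
  filter (fun s => if Rlt_dec s t then true else false) T.

Definition points_upto (T : list R) (t : R) : list R :=
  filter (fun s => if Rle_dec s t then true else false) T.

Lemma points_before_at_left (T : list R) (t : R) :
  at_left t (fun s => points_before T s = points_before T t).
Proof.
  induction T as [|x T IH]; simpl.
  - now apply filter_forall.
  - destruct (Rlt_dec x t) as [h|h].
    + apply: filter_imp (filter_and _ _ IH (at_left_between x t h)).
      intros s [H1 H2]. destruct (Rlt_dec x s); [now f_equal|lra].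
    + apply: filter_imp (filter_and _ _ IH (at_left_between (t - 1) t _)); [|lra].
      intros s [H1 H2]. destruct (Rlt_dec x s); [lra|exact H1].
Qed.

Lemma points_before_at_right (T : list R) (t : R) :
  at_right t (fun s => points_before T s = points_upto T t).
Proof.
  induction T as [|x T IH]; simpl.
  - now apply filter_forall.
  - destruct (Rle_dec x t) as [h|h].
    + apply: filter_imp (filter_and _ _ IH (at_right_between t (t + 1) _)); [|lra].
      intros s [H1 H2]. destruct (Rlt_dec x s); [now f_equal|lra].
    + apply: filter_imp (filter_and _ _ IH (at_right_between t x _)); [|lra].
      intros s [H1 H2]. destruct (Rlt_dec x s); [lra|exact H1].
Qed.

Lemma points_upto_notin (T : list R) (t : R) :
  ~ In t T -> points_upto T t = points_before T t.
Proof.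
  intros Hn. apply filter_ext_in. intros s Hs.
  destruct (Rle_dec s t), (Rlt_dec s t); try reflexivity; try lra.
  assert (s = t) by lra. now subst.
Qed.

Lemma points_before_locally (T : list R) (t : R) :
  ~ In t T -> locally t (fun s => points_before T t = points_before T s).
Proof.
  intros Hn.
  assert (Hl := points_before_at_left T t).
  assert (Hr := points_before_at_right T t). rewrite (points_upto_notin T t Hn) in Hr.
  unfold at_left, at_right, within in Hl, Hr.
  apply: filter_imp (filter_and _ _ Hl Hr). intros s [H1 H2].
  destruct (Rtotal_order s t) as [h|[->|h]]; auto.
  - now rewrite H1.
  - now rewrite H2.
Qed.

Lemma fold_points_upto (op : R -> R -> R) (e : R) (g : R -> R) (T : list R) (t : R) :
  (forall x y z, op x (op y z) = op y (op x z)) ->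
  NoDup T -> In t T ->
  fold_right op e (map g (points_upto T t)) =
  op (g t) (fold_right op e (map g (points_before T t))).
Proof.
  intros Hop. induction T as [|x T IH]; intros Hnd Hin; [destruct Hin|].
  inversion Hnd as [|? ? Hx HT]; subst. simpl. destruct Hin as [->|Hin].
  - destruct (Rle_dec t t); [|lra]. destruct (Rlt_dec t t); [lra|].
    simpl. fold (points_upto T t) (points_before T t).
    now rewrite (points_upto_notin T t Hx).
  - fold (points_upto T t) (points_before T t).
    destruct (Req_dec x t) as [->|Hxt]; [contradiction|].
    destruct (Rle_dec x t), (Rlt_dec x t); try lra; simpl; rewrite (IH HT Hin); auto.
Qed.

(** The sum, and the product, of [g] over the points of [T] lying strictly
    before [t]: left-continuous step functions of [t]. *)
Definition step_sum (g : R -> R) (T : list R) (t : R) : R :=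
  fold_right Rplus 0 (map g (points_before T t)).

Definition step_prod (g : R -> R) (T : list R) (t : R) : R :=
  fold_right Rmult 1 (map g (points_before T t)).

Lemma step_left (F : list R -> R) (T : list R) (t : R) :
  left_lim (fun s => F (points_before T s)) t (F (points_before T t)).
Proof.
  apply: (filterlim_ext_loc (fun _ => F (points_before T t))); [|apply filterlim_const].
  apply: filter_imp (points_before_at_left T t). now intros s ->.
Qed.

Lemma step_right (F : list R -> R) (T : list R) (t : R) :
  right_lim (fun s => F (points_before T s)) t (F (points_upto T t)).
Proof.
  apply: (filterlim_ext_loc (fun _ => F (points_upto T t))); [|apply filterlim_const].
  apply: filter_imp (points_before_at_right T t). now intros s ->.
Qed.

Lemma step_derive (F : list R -> R) (T : list R) (t : R) :
  ~ In t T -> is_derive (fun s => F (points_before T s)) t 0.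
Proof.
  intros Hn. apply: (is_derive_ext_loc (fun _ => F (points_before T t))).
  - apply: filter_imp (points_before_locally T t Hn). now intros s ->.
  - apply: is_derive_const.
Qed.

Lemma step_sum_right (g : R -> R) (T : list R) (t : R) :
  NoDup T -> (~ In t T -> g t = 0) ->
  right_lim (step_sum g T) t (step_sum g T t + g t).
Proof.
  intros HT Hg.
  replace (step_sum g T t + g t) with (fold_right Rplus 0 (map g (points_upto T t))).
  - apply (step_right (fun l => fold_right Rplus 0 (map g l))).
  - destruct (in_dec Req_EM_T t T) as [h|h].
    + rewrite fold_points_upto; auto; [apply Rplus_comm|]. intros; ring.
    + rewrite (points_upto_notin T t h) (Hg h). unfold step_sum. ring.
Qed.

Lemma step_prod_upto (g : R -> R) (T : list R) (t : R) :
  NoDup T -> (~ In t T -> g t = 1) ->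
  fold_right Rmult 1 (map g (points_upto T t)) = step_prod g T t * g t.
Proof.
  intros HT Hg. destruct (in_dec Req_EM_T t T) as [h|h].
  - rewrite fold_points_upto; auto; [apply Rmult_comm|]. intros; ring.
  - rewrite (points_upto_notin T t h) (Hg h). unfold step_prod. ring.
Qed.

Lemma step_prod_neq0 (g : R -> R) (T : list R) (t : R) :
  (forall s, g s <> 0) -> step_prod g T t <> 0.
Proof.
  intros Hg. unfold step_prod. induction (points_before T t) as [|x l IH]; simpl.
  - lra.
  - now apply Rmult_integral_contrapositive_currified.
Qed.

Lemma step_sum_bounds (g : R -> R) (T : list R) (t : R) :
  (forall s, 0 <= g s) ->
  0 <= step_sum g T t <= fold_right Rplus 0 (map g T).
Proof.
  intros Hg. unfold step_sum. induction T as [|x T IH]; simpl.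
  - lra.
  - fold (points_before T t). assert (Hx := Hg x).
    destruct (Rlt_dec x t); simpl; lra.
Qed.

(** * Impulsive systems with unit multipliers *)

(** A solution [(z, w)] on the open interval [(t1, t2)] of the differential
    equations off [L], with [z] free of jumps and [w] jumping by [- g t * z(t)]
    at [t]; both components have one-sided limits up to the ends. *)
Record normalized_solution (L : list R) (t1 t2 : R) (a b c g z w : R -> R) : Prop := {
  ns_z : forall t, t1 < t < t2 -> ~ In t L -> is_derive z t (a t * z t + b t * w t);
  ns_w : forall t, t1 < t < t2 -> ~ In t L -> is_derive w t (- c t * z t - a t * w t);
  ns_jump : forall t, t1 < t < t2 -> exists zt wt,
    left_lim z t zt /\ right_lim z t zt /\
    left_lim w t wt /\ right_lim w t (wt - g t * zt);
  ns_right : forall t, t1 <= t < t2 -> exists l, right_lim w t l;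
  ns_left : forall t, t1 < t <= t2 -> exists l, left_lim w t l
}.

(** The primitive of [f] from [r], increased by [g s] at each point [s] of [T]. *)
Definition impulsive_integral (f g : R -> R) (T : list R) (r t : R) : R :=
  RInt f r t + step_sum g T t.

Lemma impulsive_integral_derive (L T : list R) (f g : R -> R) (r t : R) :
  incl T L -> piecewise_continuous L f -> ~ In t L ->
  is_derive (impulsive_integral f g T r) t (f t).
Proof.
  intros HTL Hf Ht. rewrite -(Rplus_0_r (f t)).
  apply: (is_derive_plus (RInt f r) (step_sum g T)).
  - now apply (pwc_primitive_derive L).
  - apply (step_derive (fun l => fold_right Rplus 0 (map g l))). auto.
Qed.

Lemma impulsive_integral_left (L T : list R) (f g : R -> R) (r t : R) :
  piecewise_continuous L f ->
  left_lim (impulsive_integral f g T r) t (impulsive_integral f g T r t).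
Proof.
  intros Hf. apply (lim_plus _ _ (RInt f r) (step_sum g T)).
  - apply left_lim_cont. now apply (pwc_primitive_cont L).
  - apply (step_left (fun l => fold_right Rplus 0 (map g l))).
Qed.

Lemma impulsive_integral_right (L T : list R) (f g : R -> R) (r t : R) :
  piecewise_continuous L f -> NoDup T -> (~ In t T -> g t = 0) ->
  right_lim (impulsive_integral f g T r) t (impulsive_integral f g T r t + g t).
Proof.
  intros Hf HT Hg. unfold impulsive_integral at 2. rewrite Rplus_assoc.
  apply (lim_plus _ _ (RInt f r) (step_sum g T)).
  - apply right_lim_cont. now apply (pwc_primitive_cont L).
  - now apply step_sum_right.
Qed.

(** The quantity whose monotonicity carries the argument; the parameter [lam]
    plays the part of the multiplier in the discriminant proof of the
    Cauchy-Schwarz inequality. *)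
Definition energy (z w A P V : R -> R) (lam M t : R) : R :=
  z t * w t - 2 * lam * (z t * exp (- A t)) + lam ^ 2 * P t + M ^ 2 * V t.

Lemma energy_derive (z w A P V : R -> R) (lam M t dz dw dA dP dV : R) :
  is_derive z t dz -> is_derive w t dw -> is_derive A t dA ->
  is_derive P t dP -> is_derive V t dV ->
  is_derive (energy z w A P V lam M) t
    (dz * w t + z t * dw - 2 * lam * (dz * exp (- A t) - z t * dA * exp (- A t))
     + lam ^ 2 * dP + M ^ 2 * dV).
Proof.
  intros Hz Hw HA HP HV. unfold energy. auto_derive.
  - repeat split; [now exists dz|now exists dw|now exists dz|now exists dA
                  |now exists dP|now exists dV].
  - rewrite (is_derive_unique _ _ _ Hz) (is_derive_unique _ _ _ Hw)
      (is_derive_unique _ _ _ HA) (is_derive_unique _ _ _ HP) (is_derive_unique _ _ _ HV).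
    ring.
Qed.

Lemma energy_limit (F : (R -> Prop) -> Prop) (FF : Filter F)
    (z w A P V : R -> R) (lam M lz lw lA lP lV : R) :
  filterlim z F (locally lz) -> filterlim w F (locally lw) ->
  filterlim A F (locally lA) -> filterlim P F (locally lP) ->
  filterlim V F (locally lV) ->
  filterlim (energy z w A P V lam M) F
    (locally (lz * lw - 2 * lam * (lz * exp (- lA)) + lam ^ 2 * lP + M ^ 2 * lV)).
Proof.
  intros Hz Hw HA HP HV.
  apply (lim_plus F FF (fun t => z t * w t - 2 * lam * (z t * exp (- A t)) + lam ^ 2 * P t)
           (fun t => M ^ 2 * V t)); [|now apply lim_scal].
  apply (lim_plus F FF (fun t => z t * w t - 2 * lam * (z t * exp (- A t)))
           (fun t => lam ^ 2 * P t)); [|now apply lim_scal].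
  replace (lz * lw - 2 * lam * (lz * exp (- lA)))
    with (lz * lw + (- (2 * lam)) * (lz * exp (- lA))) by ring.
  apply: (filterlim_ext (fun t => z t * w t + (- (2 * lam)) * (z t * exp (- A t)))).
  { intros t. ring. }
  apply (lim_plus F FF (fun t => z t * w t) (fun t => - (2 * lam) * (z t * exp (- A t)))).
  - now apply lim_mult.
  - apply (lim_scal F FF (fun t => z t * exp (- A t))).
    apply (lim_mult F FF z (fun t => exp (- A t))); [exact Hz|].
    apply (filterlim_comp _ _ _ A (fun y => exp (- y)) _ _ _ HA).
    apply: (continuous_comp Ropp exp).
    + apply: continuous_opp. apply continuous_id.
    + apply continuous_exp.
Qed.

Lemma is_derive_left_lim (f : R -> R) (t l : R) : is_derive f t l -> left_lim f t (f t).
Proof.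
  intros H. apply left_lim_cont. apply: ex_derive_continuous. now exists l.
Qed.

Lemma sq_le_of_abs (x m : R) : Rabs x <= m -> x ^ 2 <= m ^ 2.
Proof.
  intros H. rewrite -(pow2_abs x). apply pow_incr. split; [apply Rabs_pos|exact H].
Qed.

Lemma pwc_positive_part (L : list R) (c : R -> R) :
  piecewise_continuous L c -> piecewise_continuous L (fun t => Rmax (c t) 0).
Proof.
  apply (pwc_comp L c (fun y => Rmax y 0)).
  intros y. apply: (continuous_ext (fun y => (y + Rabs y) * / 2)).
  - intros s. unfold Rmax, Rabs. destruct (Rle_dec s 0), (Rcase_abs s); lra.
  - apply: (continuous_mult (fun y => y + Rabs y) (fun _ => / 2)).
    + apply: (continuous_plus (fun y => y) Rabs);
        [apply continuous_id|apply continuous_Rabs].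
    + apply continuous_const.
Qed.

Lemma pwc_weight (L : list R) (a b : R -> R) (t0 : R) :
  piecewise_continuous L a -> piecewise_continuous L b ->
  piecewise_continuous L (fun t => b t * exp (- 2 * RInt a t0 t)).
Proof.
  intros Ha Hb. apply (pwc_mult_cont L b (fun t => exp (- 2 * RInt a t0 t))); [exact Hb|].
  intros t. apply: (continuous_comp (fun t => - 2 * RInt a t0 t) exp).
  - apply: (continuous_mult (fun _ => - 2) (RInt a t0)).
    + apply continuous_const.
    + now apply (pwc_primitive_cont L).
  - apply continuous_exp.
Qed.

(** When [|z| <= M], the derivative of the energy is
    [b (w - lam exp (- A))^2 + (M^2 c+ - c z^2) >= 0], and the downward jumps
    of [z w] are compensated by those of [M^2 V]. *)
Lemma energy_increases (L T : list R) (t1 t2 t0 lam M p q zp wp zq wq : R)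
    (a b c g z w : R -> R) :
  NoDup T -> incl T L -> (forall t, ~ In t T -> g t = 0) ->
  piecewise_continuous L a -> piecewise_continuous L b -> piecewise_continuous L c ->
  (forall t, t1 < t < t2 -> ~ In t L -> 0 <= b t) ->
  normalized_solution L t1 t2 a b c g z w ->
  t1 <= p -> p < q -> q <= t2 ->
  (forall t l, p < t < q -> left_lim z t l -> Rabs l <= M) ->
  right_lim z p zp -> right_lim w p wp -> left_lim z q zq -> left_lim w q wq ->
  let A := RInt a t0 in
  let P := RInt (fun t => b t * exp (- 2 * RInt a t0 t)) t1 in
  let V := impulsive_integral (fun t => Rmax (c t) 0) (fun t => Rmax (g t) 0) T t1 in
  zp * wp - 2 * lam * (zp * exp (- A p)) + lam ^ 2 * P p + M ^ 2 * (V p + Rmax (g p) 0)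
  <= zq * wq - 2 * lam * (zq * exp (- A q)) + lam ^ 2 * P q + M ^ 2 * V q.
Proof.
  intros HT HTL Hg Ha Hb Hc Hpos Hs Hp Hpq Hq HM Hzp Hwp Hzq Hwq A P V.
  assert (Hcp := pwc_positive_part L c Hc).
  assert (HA : forall t, continuous A t) by (intros t; now apply (pwc_primitive_cont L)).
  assert (HE := pwc_weight L a b t0 Ha Hb).
  assert (HP : forall t, continuous P t) by (intros t; now apply (pwc_primitive_cont L)).
  assert (Hg' : forall t, ~ In t T -> Rmax (g t) 0 = 0).
  { intros t Ht. rewrite (Hg t Ht). apply Rmax_left. apply Rle_refl. }
  assert (HVl : forall t, left_lim V t (V t)).
  { intros t. now apply (impulsive_integral_left L). }
  assert (HVr : forall t, right_lim V t (V t + Rmax (g t) 0)).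
  { intros t. exact (impulsive_integral_right L T (fun t => Rmax (c t) 0)
      (fun t => Rmax (g t) 0) t1 t Hcp HT (Hg' t)). }
  apply (piecewise_nondecreasing L (energy z w A P V lam M)
    (fun t => (a t * z t + b t * w t) * w t + z t * (- c t * z t - a t * w t)
       - 2 * lam * ((a t * z t + b t * w t) * exp (- A t) - z t * a t * exp (- A t))
       + lam ^ 2 * (b t * exp (- 2 * RInt a t0 t)) + M ^ 2 * Rmax (c t) 0) p q); auto.
  - intros t Ht Hn. split.
    + apply energy_derive.
      * apply (ns_z _ _ _ _ _ _ _ _ _ Hs); [lra|exact Hn].
      * apply (ns_w _ _ _ _ _ _ _ _ _ Hs); [lra|exact Hn].
      * now apply (pwc_primitive_derive L).
      * now apply (pwc_primitive_derive L (fun t => b t * exp (- 2 * RInt a t0 t))).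
      * exact (impulsive_integral_derive L T _ (fun t => Rmax (g t) 0) t1 t HTL Hcp Hn).
    + replace (exp (- 2 * RInt a t0 t)) with (exp (- A t) * exp (- A t)).
      2: { rewrite -exp_plus. f_equal. unfold A. ring. }
      set (e := exp (- A t)).
      assert (Hz2 : z t ^ 2 <= M ^ 2).
      { apply sq_le_of_abs. apply (HM t); [exact Ht|].
        apply (is_derive_left_lim _ _ _ (ns_z _ _ _ _ _ _ _ _ _ Hs t ltac:(lra) Hn)). }
      assert (Hbt : 0 <= b t) by (apply Hpos; [lra|exact Hn]).
      assert (H1 : 0 <= b t * (w t - lam * e) ^ 2).
      { apply Rmult_le_pos; [exact Hbt|apply pow2_ge_0]. }
      assert (H2 : c t * z t ^ 2 <= M ^ 2 * Rmax (c t) 0).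
      { assert (c t <= Rmax (c t) 0) by apply Rmax_l.
        assert (0 <= Rmax (c t) 0) by apply Rmax_r.
        assert (Hz0 := pow2_ge_0 (z t)). nra. }
      nra.
  - intros t Ht Hn.
    destruct (ns_jump _ _ _ _ _ _ _ _ _ Hs t) as (zt & wt & Hzl & Hzr & Hwl & Hwr); [lra|].
    eexists. eexists. split; [|split].
    + apply (energy_limit (at_left t) _ z w A P V lam M zt wt (A t) (P t) (V t));
        [exact Hzl|exact Hwl|now apply left_lim_cont|now apply left_lim_cont|apply HVl].
    + apply (energy_limit (at_right t) _ z w A P V lam M zt (wt - g t * zt)
               (A t) (P t) (V t + Rmax (g t) 0));
        [exact Hzr|exact Hwr|now apply right_lim_cont|now apply right_lim_cont|apply HVr].
    + assert (Hz2 : zt ^ 2 <= M ^ 2).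
      { apply sq_le_of_abs. now apply (HM t). }
      assert (g t <= Rmax (g t) 0) by apply Rmax_l.
      assert (0 <= Rmax (g t) 0) by apply Rmax_r.
      assert (Hz0 := pow2_ge_0 zt).
      assert (g t * zt ^ 2 <= M ^ 2 * Rmax (g t) 0) by nra.
      nra.
  - apply (energy_limit (at_right p) _ z w A P V lam M zp wp (A p) (P p) (V p + Rmax (g p) 0));
      [exact Hzp|exact Hwp|now apply right_lim_cont|now apply right_lim_cont|apply HVr].
  - apply (energy_limit (at_left q) _ z w A P V lam M zq wq (A q) (P q) (V q));
      [exact Hzq|exact Hwq|now apply left_lim_cont|now apply left_lim_cont|apply HVl].
Qed.

(** The Lyapunov inequality for a solution whose first component vanishes at
    both ends of an interval without vanishing identically on it. *)
Lemma lyapunov_lower_bound (L T : list R) (t1 t2 s1 s2 : R) (a b c g z w : R -> R) :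
  NoDup T -> incl T L -> (forall t, ~ In t T -> g t = 0) ->
  piecewise_continuous L a -> piecewise_continuous L b -> piecewise_continuous L c ->
  (forall t, t1 < t < t2 -> ~ In t L -> 0 <= b t) ->
  normalized_solution L t1 t2 a b c g z w ->
  t1 <= s1 -> s1 < s2 -> s2 <= t2 ->
  right_lim z s1 0 -> left_lim z s2 0 ->
  (exists t, s1 < t < s2 /\ ~ In t L /\ z t <> 0) ->
  exists t0, t1 < t0 < t2 /\
    4 <= RInt (fun t => b t * exp (- 2 * RInt a t0 t)) t1 t2 *
         (RInt (fun t => Rmax (c t) 0) t1 t2 +
          fold_right Rplus 0 (map (fun t => Rmax (g t) 0) T)).
Proof.
  intros HT HTL Hg Ha Hb Hc Hpos Hs Hs1 Hs12 Hs2 Hz1 Hz2 [r [Hr [Hrn Hzr0]]].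
  destruct (max_abs_limit L z s1 s2) as (t0 & z0 & Ht0 & Hzl & Hzr & HM); auto.
  { intros t Ht Hn. apply: ex_derive_continuous. eexists.
    apply (ns_z _ _ _ _ _ _ _ _ _ Hs); [lra|exact Hn]. }
  { intros t Ht. destruct (ns_jump _ _ _ _ _ _ _ _ _ Hs t) as (zt & wt & H1 & H2 & _); [lra|].
    now exists zt. }
  assert (Hz0 : z0 <> 0).
  { intros ->. apply Hzr0.
    assert (H := HM r (z r) Hr (is_derive_left_lim _ _ _
      (ns_z _ _ _ _ _ _ _ _ _ Hs r ltac:(lra) Hrn))).
    rewrite Rabs_R0 in H. assert (H' := Rabs_pos (z r)).
    destruct (Req_dec (z r) 0) as [E|E]; [exact E|]. apply Rabs_pos_lt in E. lra. }
  exists t0. split; [lra|].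
  destruct (ns_jump _ _ _ _ _ _ _ _ _ Hs t0) as (zt & wt & Hzl' & _ & Hwl & Hwr); [lra|].
  assert (zt = z0) as ->.
  { exact (filterlim_locally_unique (F := at_left t0) z zt z0 Hzl' Hzl). }
  destruct (ns_right _ _ _ _ _ _ _ _ _ Hs s1) as [w1 Hw1]; [lra|].
  destruct (ns_left _ _ _ _ _ _ _ _ _ Hs s2) as [w2 Hw2]; [lra|].
  set (E := fun t => b t * exp (- 2 * RInt a t0 t)).
  set (cp := fun t => Rmax (c t) 0). set (gp := fun t => Rmax (g t) 0).
  assert (HE : piecewise_continuous L E) by now apply (pwc_weight L a b t0).
  assert (Hcp : piecewise_continuous L cp) by now apply pwc_positive_part.
  assert (key : forall lam,
    4 * lam * z0 <= lam ^ 2 * (RInt E t1 s2 - RInt E t1 s1) +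
      z0 ^ 2 * (impulsive_integral cp gp T t1 s2 - impulsive_integral cp gp T t1 s1)).
  { intros lam.
    assert (I1 := energy_increases L T t1 t2 t0 lam (Rabs z0) s1 t0 0 w1 z0 wt
      a b c g z w HT HTL Hg Ha Hb Hc Hpos Hs Hs1 (proj1 Ht0) ltac:(lra)
      (fun t l Ht Hl => HM t l ltac:(lra) Hl) Hz1 Hw1 Hzl Hwl).
    assert (I2 := energy_increases L T t1 t2 t0 (- lam) (Rabs z0) t0 s2 z0 (wt - g t0 * z0)
      0 w2 a b c g z w HT HTL Hg Ha Hb Hc Hpos Hs ltac:(lra) (proj2 Ht0) Hs2
      (fun t l Ht Hl => HM t l ltac:(lra) Hl) Hzr Hwr Hz2 Hw2).
    cbv zeta in I1, I2. rewrite pow2_abs in I1, I2.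
    rewrite RInt_point in I1, I2.
    change (@zero R_CompleteNormedModule) with 0 in I1, I2.
    rewrite Ropp_0 exp_0 in I1, I2.
    fold E cp gp in I1, I2.
    assert (Hs0 : 0 <= Rmax (g s1) 0) by apply Rmax_r.
    assert (Hg0 : g t0 <= Rmax (g t0) 0) by apply Rmax_l.
    assert (Hsq := pow2_ge_0 z0).
    assert (z0 ^ 2 * g t0 <= z0 ^ 2 * Rmax (g t0) 0) by nra.
    assert (0 <= z0 ^ 2 * Rmax (g s1) 0) by nra.
    nra. }
  (* the bounds over [s1, s2] are weakened to bounds over [t1, t2] *)
  assert (HEc : RInt E t1 s2 - RInt E t1 s1 <= RInt E t1 t2).
  { assert (X1 : 0 <= RInt E t1 s1).
    { apply (pwc_RInt_nonneg L); auto. intros t Ht Hn.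
      apply Rmult_le_pos; [apply Hpos; [lra|exact Hn]|apply Rlt_le, exp_pos]. }
    assert (X2 : 0 <= RInt E s2 t2).
    { apply (pwc_RInt_nonneg L); auto. intros t Ht Hn.
      apply Rmult_le_pos; [apply Hpos; [lra|exact Hn]|apply Rlt_le, exp_pos]. }
    assert (X3 := RInt_Chasles E t1 s2 t2 (pwc_ex_RInt L E t1 s2 HE) (pwc_ex_RInt L E s2 t2 HE)).
    change (RInt E t1 s2 + RInt E s2 t2 = RInt E t1 t2) in X3. lra. }
  assert (HVc : impulsive_integral cp gp T t1 s2 - impulsive_integral cp gp T t1 s1
      <= RInt cp t1 t2 + fold_right Rplus 0 (map gp T)).
  { assert (cp0 : forall t, 0 <= cp t) by (intros t; apply Rmax_r).
    assert (gp0 : forall t, 0 <= gp t) by (intros t; apply Rmax_r).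
    assert (X1 : 0 <= RInt cp t1 s1) by (apply (pwc_RInt_nonneg L); auto).
    assert (X2 : 0 <= RInt cp s2 t2) by (apply (pwc_RInt_nonneg L); auto).
    assert (X3 := RInt_Chasles cp t1 s2 t2 (pwc_ex_RInt L cp t1 s2 Hcp) (pwc_ex_RInt L cp s2 t2 Hcp)).
    change (RInt cp t1 s2 + RInt cp s2 t2 = RInt cp t1 t2) in X3.
    assert (X4 := step_sum_bounds gp T s1 gp0). assert (X5 := step_sum_bounds gp T s2 gp0).
    unfold impulsive_integral. lra. }
  assert (HS0 : 0 <= RInt cp t1 t2 + fold_right Rplus 0 (map gp T)).
  { assert (0 <= RInt cp t1 t2).
    { apply (pwc_RInt_nonneg L); auto; [lra|]. intros; apply Rmax_r. }
    assert (X5 := step_sum_bounds gp T s2 (fun t => Rmax_r _ _)). lra. }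
  revert HEc HVc HS0 key.
  generalize (RInt E t1 t2) (RInt cp t1 t2 + fold_right Rplus 0 (map gp T))
    (RInt E t1 s2 - RInt E t1 s1)
    (impulsive_integral cp gp T t1 s2 - impulsive_integral cp gp T t1 s1).
  intros B S B' S' HB HS HS0 key.
  assert (Hsq : 0 < z0 ^ 2) by (apply pow2_gt_0; exact Hz0).
  (* the quadratic 4 k <= k^2 B + S, for lam = k z0 *)
  assert (key' : forall k, 4 * k <= k ^ 2 * B + S).
  { intros k. assert (K := key (k * z0)). assert (Hk := pow2_ge_0 k).
    apply (Rmult_le_reg_l (z0 ^ 2)); [exact Hsq|].
    assert (k ^ 2 * B' <= k ^ 2 * B) by nra.
    assert (z0 ^ 2 * (k ^ 2 * B') <= z0 ^ 2 * (k ^ 2 * B)) by nra.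
    assert (z0 ^ 2 * S' <= z0 ^ 2 * S) by nra.
    nra. }
  (* a nonpositive [B] is refuted by a large [k], else [k = 2 / B] is optimal *)
  destruct (Rle_lt_dec B 0) as [hB|hB].
  - assert (K := key' (S + 1)). assert (Hk := pow2_ge_0 (S + 1)). nra.
  - assert (K := key' (2 / B)).
    replace ((2 / B) ^ 2 * B) with (4 / B) in K by (field; lra).
    assert (4 * (2 / B) = 2 * (4 / B)) by (field; lra).
    assert (K' : 4 / B <= S) by lra.
    apply (Rmult_le_compat_l B) in K'; [|lra].
    replace (B * (4 / B)) with 4 in K' by (field; lra). lra.
Qed.

(** An impulse [y -> y - g x] multiplies the square norm by at most
    [(1 + |g|)^2 <= exp (2 |g|)]. *)
Lemma impulse_growth (g x y : R) :
  x ^ 2 + (y - g * x) ^ 2 <= exp (2 * Rabs g) * (x ^ 2 + y ^ 2).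
Proof.
  assert (Hg := Rabs_pos g). assert (Hg2 := pow2_abs g).
  assert (He : (1 + Rabs g) ^ 2 <= exp (2 * Rabs g)).
  { replace (exp (2 * Rabs g)) with (exp (Rabs g) ^ 2).
    - apply pow_incr. assert (He := exp_ineq1_le (Rabs g)). lra.
    - replace (2 * Rabs g) with (Rabs g + Rabs g) by ring. rewrite exp_plus. ring. }
  assert (Hxy : - (g * (x * y)) * 2 <= Rabs g * (x ^ 2 + y ^ 2)).
  { assert (H1 := Rle_abs (- (g * (x * y)))). rewrite Rabs_Ropp Rabs_mult in H1.
    assert (H2 : 2 * Rabs (x * y) <= x ^ 2 + y ^ 2).
    { assert (P1 := pow2_ge_0 (x + y)). assert (P2 := pow2_ge_0 (x - y)).
      unfold Rabs. destruct (Rcase_abs (x * y)); nra. }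
    nra. }
  assert (Hx := pow2_ge_0 x). assert (Hy := pow2_ge_0 y).
  assert ((1 + Rabs g) ^ 2 * (x ^ 2 + y ^ 2) <= exp (2 * Rabs g) * (x ^ 2 + y ^ 2)) by nra.
  assert (0 <= Rabs g * (x ^ 2 + y ^ 2)) by nra.
  assert (0 <= g ^ 2 * y ^ 2) by nra.
  nra.
Qed.

(** A Gronwall estimate, forward in time for [sg = -1] and backward for
    [sg = 1]: the square norm of a solution grows at most as the exponential of
    an impulsive integral. *)
Lemma norm_growth (L T : list R) (t1 t2 p q sg : R) (a b c g z w : R -> R) :
  sg = 1 \/ sg = -1 ->
  NoDup T -> incl T L -> (forall t, ~ In t T -> g t = 0) ->
  piecewise_continuous L a -> piecewise_continuous L b -> piecewise_continuous L c ->
  normalized_solution L t1 t2 a b c g z w ->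
  t1 < p -> p < q -> q < t2 -> ~ In p L -> ~ In q L ->
  let Th := impulsive_integral (fun t => 2 * Rabs (a t) + Rabs (b t) + Rabs (c t))
              (fun t => 2 * Rabs (g t)) T t1 in
  sg * (z p ^ 2 + w p ^ 2) * exp (sg * Th p) <= sg * (z q ^ 2 + w q ^ 2) * exp (sg * Th q).
Proof.
  intros Hsg HT HTL Hg Ha Hb Hc Hs Hp Hpq Hq HpL HqL Th.
  set (k := fun t => 2 * Rabs (a t) + Rabs (b t) + Rabs (c t)).
  set (d := fun t => 2 * Rabs (g t)).
  assert (Hk : piecewise_continuous L k).
  { apply (pwc_plus L (fun t => 2 * Rabs (a t) + Rabs (b t)) (fun t => Rabs (c t))).
    - apply (pwc_plus L (fun t => 2 * Rabs (a t)) (fun t => Rabs (b t))).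
      + apply (pwc_comp L a (fun y => 2 * Rabs y)); [|exact Ha].
        intros y. apply: (continuous_mult (fun _ => 2) Rabs);
          [apply continuous_const|apply continuous_Rabs].
      + apply (pwc_comp L b Rabs); [apply continuous_Rabs|exact Hb].
    - apply (pwc_comp L c Rabs); [apply continuous_Rabs|exact Hc]. }
  assert (Hd : forall t, ~ In t T -> d t = 0).
  { intros t Ht. unfold d. rewrite (Hg t Ht) Rabs_R0. ring. }
  assert (HThl : forall t, left_lim Th t (Th t)).
  { intros t. now apply (impulsive_integral_left L). }
  assert (HThr : forall t, right_lim Th t (Th t + d t)).
  { intros t. exact (impulsive_integral_right L T k d t1 t Hk HT (Hd t)). }
  (* across an impulse [exp (sg * Th)] changes by the factor [exp (sg * d)],
     which absorbs the jump of the square norm by [impulse_growth] *)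
  set (f := fun t => sg * (z t * z t + w t * w t) * exp (sg * Th t)).
  assert (Hf : forall t, f t = sg * (z t ^ 2 + w t ^ 2) * exp (sg * Th t)).
  { intros t. unfold f. ring. }
  assert (Hlim : forall F (FF : Filter F) lz lw lT, filterlim z F (locally lz) ->
            filterlim w F (locally lw) -> filterlim Th F (locally lT) ->
            filterlim f F (locally (sg * (lz * lz + lw * lw) * exp (sg * lT)))).
  { intros F FF lz lw lT H1 H2 H3.
    apply (lim_mult F FF (fun t => sg * (z t * z t + w t * w t)) (fun t => exp (sg * Th t))).
    - apply (lim_scal F FF (fun t => z t * z t + w t * w t)).
      apply (lim_plus F FF (fun t => z t * z t) (fun t => w t * w t)); now apply lim_mult.
    - apply (filterlim_comp _ _ _ (fun t => sg * Th t) exp _ (locally (sg * lT))).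
      + now apply lim_scal.
      + apply continuous_exp. }
  rewrite -!Hf.
  assert (Hcz : forall t, t1 < t < t2 -> ~ In t L -> continuous z t).
  { intros t Ht Hn. apply: ex_derive_continuous. eexists.
    now apply (ns_z _ _ _ _ _ _ _ _ _ Hs). }
  assert (Hcw : forall t, t1 < t < t2 -> ~ In t L -> continuous w t).
  { intros t Ht Hn. apply: ex_derive_continuous. eexists.
    now apply (ns_w _ _ _ _ _ _ _ _ _ Hs). }
  apply (piecewise_nondecreasing L f (fun t =>
    (sg * (2 * z t * (a t * z t + b t * w t) + 2 * w t * (- c t * z t - a t * w t))
     + sg * sg * k t * (z t ^ 2 + w t ^ 2)) * exp (sg * Th t)) p q); auto.
  - intros t Ht Hn.
    assert (Dz := ns_z _ _ _ _ _ _ _ _ _ Hs t ltac:(lra) Hn).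
    assert (Dw := ns_w _ _ _ _ _ _ _ _ _ Hs t ltac:(lra) Hn).
    assert (DT := impulsive_integral_derive L T k d t1 t HTL Hk Hn).
    change (is_derive Th t (k t)) in DT.
    split.
    + unfold f. clearbody Th. auto_derive.
      * repeat split; eexists; first [exact Dz|exact Dw|exact DT].
      * rewrite (is_derive_unique _ _ _ Dz) (is_derive_unique _ _ _ Dw)
          (is_derive_unique _ _ _ DT). ring.
    + apply Rmult_le_pos; [|apply Rlt_le, exp_pos].
      assert (sg * sg = 1) as -> by (destruct Hsg; subst; ring).
      unfold k.
      assert (A0 := Rabs_pos (a t)). assert (B0 := Rabs_pos (b t)). assert (C0 := Rabs_pos (c t)).
      assert (Z0 := pow2_ge_0 (z t)). assert (W0 := pow2_ge_0 (w t)).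
      assert (P1 := pow2_ge_0 (z t + w t)). assert (P2 := pow2_ge_0 (z t - w t)).
      assert (A1 : forall y, - Rabs y <= y <= Rabs y).
      { intros y. apply Rabs_le_between. apply Rle_refl. }
      assert (A2 := A1 (a t)). assert (B2 := A1 (b t)). assert (C2 := A1 (c t)).
      generalize dependent (Rabs (a t)). intros a' A0 A2.
      generalize dependent (Rabs (b t)). intros b' B0 B2.
      generalize dependent (Rabs (c t)). intros c' C0 C2.
      assert (U : forall s x y : R, sg = 1 \/ sg = -1 -> - y <= x <= y ->
                  - s <= 2 * z t * w t <= s -> - (y * s) <= sg * x * (2 * z t * w t)).
      { intros s x y [->| ->] H1 H2; nra. }
      assert (UB := U (z t ^ 2 + w t ^ 2) (b t) b' Hsg B2 ltac:(split; nra)).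
      assert (UC := U (z t ^ 2 + w t ^ 2) (- c t) c' Hsg ltac:(lra) ltac:(split; nra)).
      assert (UA : - (2 * a' * (z t ^ 2 + w t ^ 2)) <= sg * (2 * a t) * (z t ^ 2 - w t ^ 2)).
      { destruct Hsg as [->| ->]; nra. }
      nra.
  - intros t Ht Hn.
    destruct (ns_jump _ _ _ _ _ _ _ _ _ Hs t) as (zt & wt & Hzl & Hzr & Hwl & Hwr); [lra|].
    exists (sg * (zt * zt + wt * wt) * exp (sg * Th t)).
    exists (sg * (zt * zt + (wt - g t * zt) * (wt - g t * zt)) * exp (sg * (Th t + d t))).
    split; [|split].
    + exact (Hlim (at_left t) _ _ _ _ Hzl Hwl (HThl t)).
    + exact (Hlim (at_right t) _ _ _ _ Hzr Hwr (HThr t)).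
    + rewrite (Rmult_plus_distr_l sg (Th t) (d t)) exp_plus.
      assert (G1 := impulse_growth (g t) zt wt).
      assert (G2 := impulse_growth (- g t) zt (wt - g t * zt)).
      rewrite Rabs_Ropp in G2. fold (d t) in G1, G2.
      replace (wt - g t * zt - - g t * zt) with wt in G2 by ring.
      assert (HE := exp_pos (sg * Th t)).
      assert (HD := exp_pos (d t)).
      generalize dependent (exp (sg * Th t)). intros e HE.
      destruct Hsg as [->| ->].
      * rewrite !Rmult_1_l.
        replace (zt * zt + wt * wt) with (zt ^ 2 + wt ^ 2) by ring.
        replace (zt * zt + (wt - g t * zt) * (wt - g t * zt))
          with (zt ^ 2 + (wt - g t * zt) ^ 2) by ring. nra.
      * replace (-1 * d t) with (- d t) by ring. rewrite exp_Ropp.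
        assert (HD' : exp (d t) * / exp (d t) = 1) by (field; lra).
        assert (HD'' := Rinv_0_lt_compat _ HD).
        generalize dependent (/ exp (d t)). intros e' HD' HD''.
        apply (Rmult_le_compat_l e') in G1; [|lra].
        replace (e' * (exp (d t) * (zt ^ 2 + wt ^ 2)))
          with ((exp (d t) * e') * (zt ^ 2 + wt ^ 2)) in G1 by ring.
        rewrite HD' in G1.
        apply (Rmult_le_compat_l e) in G1; [|lra]. nra.
  - rewrite (_ : f p = sg * (z p * z p + w p * w p) * exp (sg * (Th p + d p))).
    + apply (Hlim (at_right p) _); [| |apply HThr]; apply right_lim_cont;
        [apply Hcz|apply Hcw]; auto; lra.
    + rewrite (Hd p); [|auto]. unfold f. now rewrite Rplus_0_r.
  - apply (Hlim (at_left q) _); [| |apply HThl]; apply left_lim_cont;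
      [apply Hcz|apply Hcw]; auto; lra.
Qed.

Lemma zero_propagates (L T : list R) (t1 t2 p q : R) (a b c g z w : R -> R) :
  NoDup T -> incl T L -> (forall t, ~ In t T -> g t = 0) ->
  piecewise_continuous L a -> piecewise_continuous L b -> piecewise_continuous L c ->
  normalized_solution L t1 t2 a b c g z w ->
  t1 < p < t2 -> t1 < q < t2 -> ~ In p L -> ~ In q L ->
  z p = 0 -> w p = 0 -> z q = 0.
Proof.
  intros HT HTL Hg Ha Hb Hc Hs Hp Hq HpL HqL Hz Hw.
  assert (sq : forall e, 0 < e -> (z q ^ 2 + w q ^ 2) * e <= 0 -> z q = 0).
  { intros e He H.
    assert (Z0 := pow2_ge_0 (z q)). assert (W0 := pow2_ge_0 (w q)).
    destruct (Req_dec (z q) 0) as [E|E]; [exact E|].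
    assert (Z1 := pow2_gt_0 (z q) E). nra. }
  destruct (Rtotal_order p q) as [h|[->|h]]; [|exact Hz|].
  - assert (K := norm_growth L T t1 t2 p q (-1) a b c g z w (or_intror eq_refl)
      HT HTL Hg Ha Hb Hc Hs ltac:(lra) h ltac:(lra) HpL HqL).
    cbv zeta in K. rewrite Hz Hw in K. eapply sq; [apply exp_pos|].
    match type of K with _ <= _ * exp ?x => instantiate (1 := x) end. lra.
  - assert (K := norm_growth L T t1 t2 q p 1 a b c g z w (or_introl eq_refl)
      HT HTL Hg Ha Hb Hc Hs ltac:(lra) h ltac:(lra) HqL HpL).
    cbv zeta in K. rewrite Hz Hw in K. eapply sq; [apply exp_pos|].
    match type of K with _ * exp ?x <= _ => instantiate (1 := x) end. lra.
Qed.

(** * Reduction to unit multipliers *)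

(** The function [f] on [[t1, t2]], extended by zero, so that a coefficient
    becomes integrable on every interval and its primitives are continuous on
    the whole line. *)
Definition truncate (t1 t2 : R) (f : R -> R) (t : R) : R :=
  if Rle_dec t1 t then if Rle_dec t t2 then f t else 0 else 0.

Lemma truncate_inside (t1 t2 : R) (f : R -> R) (t : R) :
  t1 <= t <= t2 -> truncate t1 t2 f t = f t.
Proof.
  intros Ht. unfold truncate.
  destruct (Rle_dec t1 t), (Rle_dec t t2); try reflexivity; lra.
Qed.

Lemma truncate_outside (t1 t2 : R) (f : R -> R) (t : R) :
  t < t1 \/ t2 < t -> truncate t1 t2 f t = 0.
Proof.
  intros Ht. unfold truncate.
  destruct (Rle_dec t1 t), (Rle_dec t t2); try reflexivity; lra.
Qed.

(** The finite set [L] contains all impulse points of [[t1, t2]]. *)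
Definition covers_impulses (tau : Z -> R) (t1 t2 : R) (L : list R) : Prop :=
  forall i : Z, t1 <= tau i <= t2 -> In (tau i) L.

Lemma imp_dom_off (tau : Z -> R) (t1 t2 : R) (L : list R) (t : R) :
  covers_impulses tau t1 t2 L -> t1 <= t <= t2 -> ~ In t L -> imp_dom tau t1 t2 t.
Proof.
  intros HL Ht Hn. split; [exact Ht|]. intros i ->. now apply Hn, HL.
Qed.

Lemma imp_dom_locally (tau : Z -> R) (t1 t2 : R) (L : list R) (t : R) :
  covers_impulses tau t1 t2 L -> t1 < t < t2 -> ~ In t L ->
  locally t (imp_dom tau t1 t2).
Proof.
  intros HL Ht Hn.
  apply: filter_imp (filter_and _ _ (locally_between _ _ _ Ht) (locally_avoid_off L t Hn)).
  intros s [H1 H2]. apply (imp_dom_off tau t1 t2 L); auto. lra.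
Qed.

Lemma imp_dom_at_right (tau : Z -> R) (t1 t2 : R) (L : list R) (t : R) :
  covers_impulses tau t1 t2 L -> t1 <= t < t2 -> at_right t (imp_dom tau t1 t2).
Proof.
  intros HL Ht.
  apply: filter_imp (filter_and _ _ (at_right_between t t2 (proj2 Ht)) (at_right_avoid L t)).
  intros s [H1 H2]. apply (imp_dom_off tau t1 t2 L); auto. lra.
Qed.

Lemma imp_dom_at_left (tau : Z -> R) (t1 t2 : R) (L : list R) (t : R) :
  covers_impulses tau t1 t2 L -> t1 < t <= t2 -> at_left t (imp_dom tau t1 t2).
Proof.
  intros HL Ht.
  apply: filter_imp (filter_and _ _ (at_left_between t1 t (proj1 Ht)) (at_left_avoid L t)).
  intros s [H1 H2]. apply (imp_dom_off tau t1 t2 L); auto. lra.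
Qed.

(** At a point of its domain, a function continuous within the domain has its
    value as one-sided limit from inside [[t1, t2]]. *)
Lemma imp_dom_right_lim (tau : Z -> R) (t1 t2 : R) (L : list R) (f : R -> R) (t : R) :
  covers_impulses tau t1 t2 L -> continuous_on (imp_dom tau t1 t2) f ->
  imp_dom tau t1 t2 t -> t < t2 -> right_lim f t (f t).
Proof.
  intros HL Hf Hd Ht.
  assert (Hr := imp_dom_at_right tau t1 t2 L t HL (conj (proj1 (proj1 Hd)) Ht)).
  intros P HP.
  assert (H : locally t (fun s => imp_dom tau t1 t2 s -> P (f s))) by exact (Hf t Hd P HP).
  change (locally t (fun s => t < s -> imp_dom tau t1 t2 s)) in Hr.
  change (locally t (fun s => t < s -> P (f s))).
  apply: filter_imp (filter_and _ _ Hr H). intros s [H1 H2] Hs. now apply H2, H1.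
Qed.

Lemma imp_dom_left_lim (tau : Z -> R) (t1 t2 : R) (L : list R) (f : R -> R) (t : R) :
  covers_impulses tau t1 t2 L -> continuous_on (imp_dom tau t1 t2) f ->
  imp_dom tau t1 t2 t -> t1 < t -> left_lim f t (f t).
Proof.
  intros HL Hf Hd Ht.
  assert (Hr := imp_dom_at_left tau t1 t2 L t HL (conj Ht (proj2 (proj1 Hd)))).
  intros P HP.
  assert (H : locally t (fun s => imp_dom tau t1 t2 s -> P (f s))) by exact (Hf t Hd P HP).
  change (locally t (fun s => s < t -> imp_dom tau t1 t2 s)) in Hr.
  change (locally t (fun s => s < t -> P (f s))).
  apply: filter_imp (filter_and _ _ Hr H). intros s [H1 H2] Hs. now apply H2, H1.
Qed.

Lemma PC_right_lim (tau : Z -> R) (t1 t2 : R) (L : list R) (f : R -> R) (t : R) :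
  covers_impulses tau t1 t2 L -> PC tau t1 t2 f -> t1 <= t < t2 ->
  exists l, right_lim f t l.
Proof.
  intros HL [Hc Hi] Ht.
  destruct (classic (exists i, t = tau i)) as [[i ->]|Hn].
  - now apply Hi.
  - exists (f t). apply (imp_dom_right_lim tau t1 t2 L); auto; [|lra].
    split; [lra|]. intros i E. apply Hn. now exists i.
Qed.

Lemma PC_left_lim (tau : Z -> R) (t1 t2 : R) (L : list R) (f : R -> R) (t : R) :
  covers_impulses tau t1 t2 L -> PC tau t1 t2 f -> t1 < t <= t2 ->
  exists l, left_lim f t l.
Proof.
  intros HL [Hc Hi] Ht.
  destruct (classic (exists i, t = tau i)) as [[i ->]|Hn].
  - now apply Hi.
  - exists (f t). apply (imp_dom_left_lim tau t1 t2 L); auto; [|lra].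
    split; [lra|]. intros i E. apply Hn. now exists i.
Qed.

Lemma PC_truncate (tau : Z -> R) (t1 t2 : R) (L : list R) (f : R -> R) :
  covers_impulses tau t1 t2 L -> In t1 L -> In t2 L -> t1 < t2 ->
  PC tau t1 t2 f -> piecewise_continuous L (truncate t1 t2 f).
Proof.
  intros HL HL1 HL2 Ht12 Hf. split; [|intros t; split].
  - intros t Hn.
    assert (Ht : t < t1 \/ t1 < t < t2 \/ t2 < t).
    { destruct (Rtotal_order t t1) as [h|[->|h]]; [now left|contradiction|].
      destruct (Rtotal_order t t2) as [h'|[->|h']]; [|contradiction|]; lra. }
    destruct Ht as [Ht|[Ht|Ht]].
    + apply: (continuous_ext_loc _ (fun _ => 0)); [|apply continuous_const].
      apply: filter_imp (locally_between (t - 1) t1 t _); [|lra].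
      intros s Hs. rewrite truncate_outside; [reflexivity|lra].
    + apply: (continuous_ext_loc _ f).
      * apply: filter_imp (locally_between t1 t2 t Ht).
        intros s Hs. rewrite truncate_inside; [reflexivity|lra].
      * assert (Hd : imp_dom tau t1 t2 t) by (apply (imp_dom_off tau t1 t2 L); auto; lra).
        apply cont_of_limits.
        -- apply (imp_dom_left_lim tau t1 t2 L); auto; [apply Hf|lra].
        -- apply (imp_dom_right_lim tau t1 t2 L); auto; [apply Hf|lra].
    + apply: (continuous_ext_loc _ (fun _ => 0)); [|apply continuous_const].
      apply: filter_imp (locally_between t2 (t + 1) t _); [|lra].
      intros s Hs. rewrite truncate_outside; [reflexivity|lra].
  - destruct (Rlt_dec t1 t) as [h1|h1]; [destruct (Rle_dec t t2) as [h2|h2]|].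
    + destruct (PC_left_lim tau t1 t2 L f t HL Hf) as [l Hl]; [lra|].
      exists l. apply: filterlim_ext_loc Hl.
      apply: filter_imp (at_left_between t1 t h1).
      intros s Hs. rewrite truncate_inside; [reflexivity|lra].
    + exists 0. apply: (filterlim_ext_loc (fun _ => 0)); [|apply filterlim_const].
      apply: filter_imp (at_left_between t2 t _); [|lra].
      intros s Hs. rewrite truncate_outside; [reflexivity|lra].
    + exists 0. apply: (filterlim_ext_loc (fun _ => 0)); [|apply filterlim_const].
      apply: filter_imp (at_left_between (t - 1) t _); [|lra].
      intros s Hs. rewrite truncate_outside; [reflexivity|lra].
  - destruct (Rle_dec t1 t) as [h1|h1]; [destruct (Rlt_dec t t2) as [h2|h2]|].
    + destruct (PC_right_lim tau t1 t2 L f t HL Hf) as [l Hl]; [lra|].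
      exists l. apply: filterlim_ext_loc Hl.
      apply: filter_imp (at_right_between t t2 h2).
      intros s Hs. rewrite truncate_inside; [reflexivity|lra].
    + exists 0. apply: (filterlim_ext_loc (fun _ => 0)); [|apply filterlim_const].
      apply: filter_imp (at_right_between t (t + 1) _); [|lra].
      intros s Hs. rewrite truncate_outside; [reflexivity|lra].
    + exists 0. apply: (filterlim_ext_loc (fun _ => 0)); [|apply filterlim_const].
      apply: filter_imp (at_right_between t t1 _); [|lra].
      intros s Hs. rewrite truncate_outside; [reflexivity|lra].
Qed.

Lemma is_derive_within_locally (D : R -> Prop) (f : R -> R) (t l : R) :
  locally t D -> is_derive_within D f t l -> is_derive f t l.
Proof.
  intros HD [H1 H2]. split; [exact H1|].
  intros x Hx eps.
  assert (Hx' : is_filter_lim (within D (locally t)) x).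
  { intros P HP. apply: filter_imp (Hx P HP). auto. }
  apply: filter_imp (filter_and _ _ HD (H2 x Hx' eps)).
  intros s [H3 H4]. now apply H4.
Qed.

Lemma is_derive_within_continuous_on (D : R -> Prop) (f df : R -> R) :
  (forall t, D t -> is_derive_within D f t (df t)) -> continuous_on D f.
Proof.
  intros H t Ht.
  apply (filterdiff_continuous_aux f).
  - eexists. exact (H t Ht).
  - intros P HP. apply: filter_imp HP. auto.
Qed.

Lemma solution_PC (tau : Z -> R) (t1 t2 : R) (a b c : R -> R) (alpha beta : Z -> R)
    (x u : R -> R) :
  is_solution tau t1 t2 a b c alpha beta x u -> PC tau t1 t2 x /\ PC tau t1 t2 u.
Proof.
  intros (Hd & Hx & Hu & _). split; (split; [|assumption]).
  - apply (is_derive_within_continuous_on _ x (fun t => a t * x t + b t * u t)).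
    intros t Ht. now apply Hd.
  - apply (is_derive_within_continuous_on _ u (fun t => - c t * x t - a t * u t)).
    intros t Ht. now apply Hd.
Qed.

Lemma tau_lt (tau : Z -> R) (i j : Z) :
  (forall i : Z, tau i < tau (i + 1)%Z) -> (i < j)%Z -> tau i < tau j.
Proof.
  intros H Hij.
  assert (G : forall n : nat, tau i < tau (i + Z.of_nat (S n))%Z).
  { induction n as [|n IH].
    - apply H.
    - apply (Rlt_trans _ _ _ IH).
      replace (i + Z.of_nat (S (S n)))%Z with (i + Z.of_nat (S n) + 1)%Z by lia.
      apply H. }
  replace j with (i + Z.of_nat (S (Z.to_nat (j - i - 1))))%Z by lia. apply G.
Qed.

Lemma tau_inj (tau : Z -> R) (i j : Z) :
  (forall i : Z, tau i < tau (i + 1)%Z) -> tau i = tau j -> i = j.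
Proof.
  intros H E. destruct (Z.lt_total i j) as [h|[h|h]]; [|exact h|];
    apply (tau_lt tau _ _ H) in h; lra.
Qed.

Lemma Zsum_spec (P : Z -> Prop) (f : Z -> R) :
  finitely_many P -> is_Zsum P f (Zsum P f).
Proof.
  intros [l Hl]. apply (epsilon_spec (inhabits 0) (is_Zsum P f)).
  pose (dec := fun i => if excluded_middle_informative (P i) then true else false).
  pose (l' := nodup Z.eq_dec (filter dec l)).
  exists (fold_right Rplus 0 (map f l')), l'. split; [apply NoDup_nodup|split; [|reflexivity]].
  intros i. unfold l'. rewrite nodup_In filter_In. unfold dec.
  destruct (excluded_middle_informative (P i)) as [h|h]; split; try tauto.
  - intros _. split; [now apply Hl|reflexivity].
  - intros [_ E]. discriminate E.
Qed.

(** The value of [v] at the index [i] with [tau i = s] if the point [s] is in [T],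
    and the default value [e] elsewhere. *)
Definition at_impulse (tau : Z -> R) (T : list R) (e : R) (v : Z -> R) (s : R) : R :=
  if in_dec Req_EM_T s T
  then v (epsilon (inhabits 0%Z) (fun i => tau i = s)) else e.

Lemma at_impulse_tau (tau : Z -> R) (T : list R) (e : R) (v : Z -> R) (i : Z) :
  (forall i : Z, tau i < tau (i + 1)%Z) -> In (tau i) T ->
  at_impulse tau T e v (tau i) = v i.
Proof.
  intros H Hin. unfold at_impulse.
  destruct (in_dec Req_EM_T (tau i) T) as [h|h]; [|contradiction].
  f_equal. apply (tau_inj tau); [exact H|].
  apply (epsilon_spec (inhabits 0%Z) (fun j => tau j = tau i)). now exists i.
Qed.

Lemma at_impulse_off (tau : Z -> R) (T : list R) (e : R) (v : Z -> R) (s : R) :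
  ~ In s T -> at_impulse tau T e v s = e.
Proof.
  intros H. unfold at_impulse. destruct (in_dec Req_EM_T s T); [contradiction|reflexivity].
Qed.

Lemma is_derive_scaled (f h : R -> R) (t k l : R) :
  is_derive f t l -> locally t (fun s => f s * k = h s) -> is_derive h t (l * k).
Proof.
  intros Hf Hh. apply (is_derive_ext_loc (fun s => f s * k)); [exact Hh|].
  auto_derive; [now exists l|]. rewrite (is_derive_unique _ _ _ Hf). ring.
Qed.

(** Dividing a solution by the product of the multipliers met so far removes
    the jumps of the first component. *)
Lemma normalize_solution (tau : Z -> R) (t1 t2 : R) (L T : list R) (a b c : R -> R)
    (alpha beta : Z -> R) (x u : R -> R) :
  (forall i : Z, tau i < tau (i + 1)%Z) -> (forall i : Z, alpha i <> 0) ->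
  covers_impulses tau t1 t2 L -> incl T L -> NoDup T ->
  (forall s, In s T -> exists i, s = tau i) ->
  (forall i, t1 <= tau i < t2 -> In (tau i) T) ->
  is_solution tau t1 t2 a b c alpha beta x u ->
  let p := step_prod (at_impulse tau T 1 alpha) T in
  normalized_solution L t1 t2 (truncate t1 t2 a) (truncate t1 t2 b) (truncate t1 t2 c)
    (at_impulse tau T 0 (fun i => beta i / alpha i))
    (fun t => x t * / p t) (fun t => u t * / p t).
Proof.
  intros Htau Halpha HL HTL HT HTt HTc Hsol p.
  destruct (solution_PC _ _ _ _ _ _ _ _ _ _ Hsol) as [Hx Hu].
  destruct Hsol as (Hd & _ & _ & Hj).
  set (al := at_impulse tau T 1 alpha) in *.
  assert (al0 : forall s, al s <> 0).
  { intros s. unfold al, at_impulse. destruct (in_dec Req_EM_T s T); [apply Halpha|lra]. }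
  assert (p0 : forall t, p t <> 0) by (intros t; now apply step_prod_neq0).
  assert (pl : forall t, left_lim (fun s => / p s) t (/ p t)).
  { intros t. exact (step_left (fun l => / fold_right Rmult 1 (map al l)) T t). }
  assert (pr : forall t, right_lim (fun s => / p s) t (/ (p t * al t))).
  { intros t. unfold p at 2. rewrite -step_prod_upto.
    - exact (step_right (fun l => / fold_right Rmult 1 (map al l)) T t).
    - exact HT.
    - intros h. now apply at_impulse_off. }
  assert (pc : forall t, ~ In t L -> locally t (fun s => p s = p t)).
  { intros t Hn. assert (Hn' : ~ In t T) by auto.
    apply: filter_imp (points_before_locally T t Hn'). intros s E.
    unfold p, step_prod. now rewrite E. }
  split.
  - intros t Ht Hn. rewrite !truncate_inside; try lra.
    assert (Hdom : imp_dom tau t1 t2 t) by (apply (imp_dom_off tau t1 t2 L); auto; lra).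
    replace (a t * (x t * / p t) + b t * (u t * / p t))
      with ((a t * x t + b t * u t) * / p t) by ring.
    apply (is_derive_scaled x).
    + apply (is_derive_within_locally (imp_dom tau t1 t2)).
      * now apply (imp_dom_locally tau t1 t2 L).
      * now apply Hd.
    + apply: filter_imp (pc t Hn). now intros s ->.
  - intros t Ht Hn. rewrite !truncate_inside; try lra.
    assert (Hdom : imp_dom tau t1 t2 t) by (apply (imp_dom_off tau t1 t2 L); auto; lra).
    replace (- c t * (x t * / p t) - a t * (u t * / p t))
      with ((- c t * x t - a t * u t) * / p t) by ring.
    apply (is_derive_scaled u).
    + apply (is_derive_within_locally (imp_dom tau t1 t2)).
      * now apply (imp_dom_locally tau t1 t2 L).
      * now apply Hd.
    + apply: filter_imp (pc t Hn). now intros s ->.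
  - intros t Ht.
    destruct (PC_left_lim tau t1 t2 L x t HL Hx) as [xm Hxm]; [lra|].
    destruct (PC_right_lim tau t1 t2 L x t HL Hx) as [xp Hxp]; [lra|].
    destruct (PC_left_lim tau t1 t2 L u t HL Hu) as [um Hum]; [lra|].
    destruct (PC_right_lim tau t1 t2 L u t HL Hu) as [up Hup]; [lra|].
    assert (Pt := p0 t).
    assert (E : xp * / (p t * al t) = xm * / p t /\
                up * / (p t * al t) = um * / p t -
                  at_impulse tau T 0 (fun i => beta i / alpha i) t * (xm * / p t)).
    { destruct (in_dec Req_EM_T t T) as [h|h].
      - destruct (HTt t h) as [i ->]. unfold al. rewrite !at_impulse_tau; auto.
        destruct (Hj i Ht xm xp um up Hxm Hxp Hum Hup) as [-> ->].
        assert (Ha := Halpha i). split; field; auto.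
      - unfold al. rewrite !at_impulse_off; auto.
        assert (Hdom : imp_dom tau t1 t2 t).
        { split; [lra|]. intros i ->. apply h, HTc. lra. }
        assert (xm = x t) as ->.
        { apply (filterlim_locally_unique (F := at_left t) x); [exact Hxm|].
          apply (imp_dom_left_lim tau t1 t2 L); auto; [apply Hx|lra]. }
        assert (xp = x t) as ->.
        { apply (filterlim_locally_unique (F := at_right t) x); [exact Hxp|].
          apply (imp_dom_right_lim tau t1 t2 L); auto; [apply Hx|lra]. }
        assert (um = u t) as ->.
        { apply (filterlim_locally_unique (F := at_left t) u); [exact Hum|].
          apply (imp_dom_left_lim tau t1 t2 L); auto; [apply Hu|lra]. }
        assert (up = u t) as ->.
        { apply (filterlim_locally_unique (F := at_right t) u); [exact Hup|].
          apply (imp_dom_right_lim tau t1 t2 L); auto; [apply Hu|lra]. }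
        rewrite Rmult_1_r. split; ring. }
    destruct E as [E1 E2].
    exists (xm * / p t), (um * / p t). split; [|split; [|split]].
    + exact (lim_mult _ _ x (fun s => / p s) _ _ Hxm (pl t)).
    + rewrite -E1. exact (lim_mult _ _ x (fun s => / p s) _ _ Hxp (pr t)).
    + exact (lim_mult _ _ u (fun s => / p s) _ _ Hum (pl t)).
    + rewrite -E2. exact (lim_mult _ _ u (fun s => / p s) _ _ Hup (pr t)).
  - intros t Ht. destruct (PC_right_lim tau t1 t2 L u t HL Hu) as [l Hl]; [lra|].
    eexists. exact (lim_mult _ _ u (fun s => / p s) _ _ Hl (pr t)).
  - intros t Ht. destruct (PC_left_lim tau t1 t2 L u t HL Hu) as [l Hl]; [lra|].
    eexists. exact (lim_mult _ _ u (fun s => / p s) _ _ Hl (pl t)).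
Qed.

(** * Disconjugacy *)

(** At an interior point, the first component of a normalized solution has a
    two-sided limit, so a zero of [x] on either side is a zero on both. *)
Lemma zero_right_lim (L T : list R) (t1 t2 s : R) (a b c g al x w : R -> R) :
  normalized_solution L t1 t2 a b c g (fun t => x t * / step_prod al T t) w ->
  is_zero t1 t2 x s -> t1 <= s < t2 -> right_lim (fun t => x t * / step_prod al T t) s 0.
Proof.
  intros Hs [[H0 H]|[_ H]] Hst.
  - destruct (ns_jump _ _ _ _ _ _ _ _ _ Hs s) as (zt & wt & Hl & Hr & _); [lra|].
    assert (E := lim_mult _ _ x (fun t => / step_prod al T t) _ _ H
      (step_left (fun l => / fold_right Rmult 1 (map al l)) T s)).
    rewrite Rmult_0_l in E.
    now rewrite (filterlim_locally_unique (F := at_left s) _ 0 zt E Hl).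
  - assert (E := lim_mult _ _ x (fun t => / step_prod al T t) _ _ H
      (step_right (fun l => / fold_right Rmult 1 (map al l)) T s)).
    now rewrite Rmult_0_l in E.
Qed.

Lemma zero_left_lim (L T : list R) (t1 t2 s : R) (a b c g al x w : R -> R) :
  normalized_solution L t1 t2 a b c g (fun t => x t * / step_prod al T t) w ->
  is_zero t1 t2 x s -> t1 < s <= t2 -> left_lim (fun t => x t * / step_prod al T t) s 0.
Proof.
  intros Hs [[_ H]|[H0 H]] Hst.
  - assert (E := lim_mult _ _ x (fun t => / step_prod al T t) _ _ H
      (step_left (fun l => / fold_right Rmult 1 (map al l)) T s)).
    now rewrite Rmult_0_l in E.
  - destruct (ns_jump _ _ _ _ _ _ _ _ _ Hs s) as (zt & wt & Hl & Hr & _); [lra|].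
    assert (E := lim_mult _ _ x (fun t => / step_prod al T t) _ _ H
      (step_right (fun l => / fold_right Rmult 1 (map al l)) T s)).
    rewrite Rmult_0_l in E.
    now rewrite (filterlim_locally_unique (F := at_right s) _ 0 zt E Hr).
Qed.

(** If the first component vanishes on an interval then so does [b w], hence
    [w], and uniqueness makes the first component vanish everywhere. *)
Lemma zero_on_interval (L T : list R) (t1 t2 s1 s2 : R) (a b c g z w : R -> R) :
  NoDup T -> incl T L -> (forall t, ~ In t T -> g t = 0) ->
  piecewise_continuous L a -> piecewise_continuous L b -> piecewise_continuous L c ->
  (forall t, t1 < t < t2 -> ~ In t L -> 0 < b t) ->
  normalized_solution L t1 t2 a b c g z w ->
  t1 <= s1 -> s1 < s2 -> s2 <= t2 ->
  (forall t, s1 < t < s2 -> ~ In t L -> z t = 0) ->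
  forall t, t1 < t < t2 -> ~ In t L -> z t = 0.
Proof.
  intros HT HTL Hg Ha Hb Hc Hpos Hs H1 H12 H2 Hz t Ht Hn.
  (* a point [m] of the interval off the exceptional set *)
  destruct (filter_ex _ (filter_and _ _ (at_right_between s1 s2 H12) (at_right_avoid L s1)))
    as [m [Hm Hmn]].
  assert (Hzm := Hz m Hm Hmn).
  assert (Dz := ns_z _ _ _ _ _ _ _ _ _ Hs m ltac:(lra) Hmn).
  assert (D0 : is_derive z m 0).
  { apply (is_derive_ext_loc (fun _ => 0)).
    - apply: filter_imp (filter_and _ _ (locally_between s1 s2 m Hm) (locally_avoid_off L m Hmn)).
      intros s [A B]. symmetry. now apply Hz.
    - apply: is_derive_const. }
  assert (E := is_derive_unique _ _ _ Dz). rewrite (is_derive_unique _ _ _ D0) Hzm in E.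
  assert (Hbm := Hpos m ltac:(lra) Hmn).
  assert (Hwm : w m = 0).
  { apply (Rmult_eq_reg_l (b m)); lra. }
  apply (zero_propagates L T t1 t2 m t a b c g z w); auto. lra.
Qed.

Theorem theorem5p2 (t1 t2 : R) (tau : Z -> R) (a b c : R -> R)
    (alpha beta : Z -> R)
    (ht : t1 < t2)
    (htau : forall i : Z, tau i < tau (i + 1)%Z)
    (hfin : finitely_many (fun i : Z => t1 <= tau i <= t2))
    (ha : PC tau t1 t2 a) (hb : PC tau t1 t2 b) (hc : PC tau t1 t2 c)
    (hbpos : forall t : R, imp_dom tau t1 t2 t -> 0 < b t)
    (halpha : forall i : Z, alpha i <> 0)
    (hineq : forall t0 : R, t1 < t0 < t2 ->
       RInt (fun t : R => b t * exp (- 2 * RInt a t0 t)) t1 t2 *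
       (RInt (fun t : R => Rmax (c t) 0) t1 t2 +
        Zsum (fun i : Z => t1 <= tau i < t2)
             (fun i : Z => Rmax (beta i / alpha i) 0)) < 4) :
  disconjugate tau t1 t2 a b c alpha beta.
Proof.
  intros (x & u & Hsol & (ts & Hts & Hxts) & r1 & r2 & Hr & Hz1 & Hz2).
  assert (Hord : exists s1 s2, s1 < s2 /\ is_zero t1 t2 x s1 /\ is_zero t1 t2 x s2).
  { destruct (Rtotal_order r1 r2) as [h|[h|h]]; [|contradiction|].
    - now exists r1, r2.
    - now exists r2, r1. }
  clear r1 r2 Hr Hz1 Hz2. destruct Hord as (s1 & s2 & Hs12 & Hz1 & Hz2).
  assert (Hs1 : t1 <= s1) by (destruct Hz1 as [[? _]|[? _]]; lra).
  assert (Hs2 : s2 <= t2) by (destruct Hz2 as [[? _]|[? _]]; lra).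
  (* T lists the impulse points that enter the sum, L all exceptional points *)
  destruct (Zsum_spec (fun i => t1 <= tau i < t2) (fun i => Rmax (beta i / alpha i) 0))
    as (lT & HND & HlT & HSum).
  { destruct hfin as [l Hl]. exists l. intros i Hi. apply Hl. lra. }
  destruct hfin as [l Hl].
  set (T := map tau lT). set (L := t1 :: t2 :: map tau l).
  assert (HT : NoDup T).
  { apply (Injective_map_NoDup (f := tau)); [|exact HND].
    intros i j. now apply tau_inj. }
  assert (HL : covers_impulses tau t1 t2 L).
  { intros i Hi. right. right. now apply in_map, Hl. }
  assert (HTt : forall s, In s T -> exists i, s = tau i).
  { intros s Hs. apply in_map_iff in Hs. destruct Hs as [i [E _]]. now exists i. }
  assert (HTc : forall i, t1 <= tau i < t2 -> In (tau i) T).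
  { intros i Hi. now apply in_map, HlT. }
  assert (HTL : incl T L).
  { intros s Hs. apply in_map_iff in Hs. destruct Hs as [i [<- Hi]].
    apply HlT in Hi. apply HL. lra. }
  assert (PCt : forall f, PC tau t1 t2 f -> piecewise_continuous L (truncate t1 t2 f)).
  { intros f Hf. apply (PC_truncate tau); auto; [now left|right; now left]. }
  assert (Ha := PCt a ha). assert (Hb := PCt b hb). assert (Hc := PCt c hc).
  assert (Hpos : forall t, t1 < t < t2 -> ~ In t L -> 0 < truncate t1 t2 b t).
  { intros t Ht Hn. rewrite truncate_inside; [|lra]. apply hbpos.
    apply (imp_dom_off tau t1 t2 L); auto. lra. }
  assert (Hg : forall t, ~ In t T -> at_impulse tau T 0 (fun i => beta i / alpha i) t = 0).
  { intros t. apply at_impulse_off. }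
  assert (Hs := normalize_solution tau t1 t2 L T a b c alpha beta x u
    htau halpha HL HTL HT HTt HTc Hsol).
  cbv zeta in Hs.
  assert (Hzr := zero_right_lim _ _ _ _ s1 _ _ _ _ _ _ _ Hs Hz1 ltac:(lra)).
  assert (Hzl := zero_left_lim _ _ _ _ s2 _ _ _ _ _ _ _ Hs Hz2 ltac:(lra)).
  set (p := step_prod (at_impulse tau T 1 alpha) T) in *.
  set (z := fun t => x t * / p t) in *.
  set (g := at_impulse tau T 0 (fun i => beta i / alpha i)) in *.
  destruct (classic (exists t, s1 < t < s2 /\ ~ In t L /\ z t <> 0)) as [Hex|Hex].
  - destruct (lyapunov_lower_bound L T t1 t2 s1 s2 _ _ _ g z _ HT HTL Hg Ha Hb Hc
      (fun t Ht Hn => Rlt_le _ _ (Hpos t Ht Hn)) Hs Hs1 Hs12 Hs2 Hzr Hzl Hex)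
      as (t0 & Ht0 & Hge).
    assert (Hlt := hineq t0 Ht0). rewrite HSum in Hlt.
    apply (Rle_not_lt _ _ Hge).
    replace (fold_right Rplus 0 (map (fun t => Rmax (g t) 0) T))
      with (fold_right Rplus 0 (map (fun i => Rmax (beta i / alpha i) 0) lT)).
    2: { unfold T at 1. rewrite map_map. f_equal. apply map_ext_in. intros i Hi.
         unfold g. rewrite at_impulse_tau; auto. now apply in_map. }
    rewrite (RInt_ext (fun t => Rmax (truncate t1 t2 c t) 0) (fun t => Rmax (c t) 0)).
    2: { intros t Ht. rewrite Rmin_left in Ht; [|lra]. rewrite Rmax_right in Ht; [|lra].
         rewrite truncate_inside; [reflexivity|lra]. }
    rewrite (RInt_ext
      (fun t => truncate t1 t2 b t * exp (- 2 * RInt (truncate t1 t2 a) t0 t))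
      (fun t => b t * exp (- 2 * RInt a t0 t))); [exact Hlt|].
    intros t Ht. rewrite Rmin_left in Ht; [|lra]. rewrite Rmax_right in Ht; [|lra].
    rewrite truncate_inside; [|lra].
    rewrite (RInt_ext (truncate t1 t2 a) a); [reflexivity|].
    intros s Hss. apply truncate_inside.
    assert (H1 := Rmin_glb_lt t0 t t1 (proj1 Ht0) (proj1 Ht)).
    assert (H2 := Rmax_lub_lt t0 t t2 (proj2 Ht0) (proj2 Ht)). lra.
  - assert (Hz : forall t, t1 < t < t2 -> ~ In t L -> z t = 0).
    { apply (zero_on_interval L T t1 t2 s1 s2 _ _ _ g z _ HT HTL Hg Ha Hb Hc Hpos Hs Hs1 Hs12 Hs2).
      intros t Ht Hn. apply NNPP. intros Hzt. apply Hex. now exists t. }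
    assert (p0 : forall t, p t <> 0).
    { intros t. apply step_prod_neq0. intros s. unfold at_impulse.
      destruct (in_dec Req_EM_T s T); [apply halpha|lra]. }
    assert (Hx0 : forall t, t1 < t < t2 -> ~ In t L -> x t = 0).
    { intros t Ht Hn. assert (E := Hz t Ht Hn). unfold z in E.
      apply Rmult_integral in E. destruct E as [E|E]; [exact E|].
      now apply Rinv_neq_0_compat in E. }
    apply Hxts. destruct (solution_PC _ _ _ _ _ _ _ _ _ _ Hsol) as [[Hcx _] _].
    destruct (Rlt_dec ts t2) as [h|h].
    + apply (filterlim_locally_unique (F := at_right ts) x).
      * apply (imp_dom_right_lim tau t1 t2 L); auto.
      * apply: (filterlim_ext_loc (fun _ => 0)); [|apply filterlim_const].
        apply: filter_imp (filter_and _ _ (at_right_between ts t2 h) (at_right_avoid L ts)).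
        intros s [A B]. symmetry. apply Hx0; [|exact B]. destruct Hts. lra.
    + assert (h1 : t1 < ts) by lra.
      apply (filterlim_locally_unique (F := at_left ts) x).
      * apply (imp_dom_left_lim tau t1 t2 L); auto.
      * apply: (filterlim_ext_loc (fun _ => 0)); [|apply filterlim_const].
        apply: filter_imp (filter_and _ _ (at_left_between t1 ts h1) (at_left_avoid L ts)).
        intros s [A B]. symmetry. apply Hx0; [|exact B]. destruct Hts. lra.
Qed.
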